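(* Let $1\le m\le d$ be integers and let $f:[0,1]^d\to\mathbb{R}^m$ be a non-constant $\mathcal{C}^1$ function. Then for every $\varepsilon>0$, $$\mathcal{N}_f(\varepsilon)\le d\,2^{2m+d-1}\,d!\cdot\frac{1}{\beta_f^{-1}(\varepsilon)} .$$
   Context: For $g\in\mathcal{C}^1([0,1]^d,\mathbb{R}^m)$ with Jacobian matrix $Dg(x)\in\mathbb{R}^{m\times d}$, the critical set is $\Sigma_g=\{x\in(0,1)^d:\operatorname{rank}(Dg(x))\le m-1\}$. For $f\in\mathcal{C}^1([0,1]^d,\mathbb{R}^m)$ and $\varepsilon>0$, $$\mathcal{N}_f(\varepsilon)=\inf\left\{\mathcal{H}^{d-1}(\Sigma_g): g\in\mathcal{C}^1([0,1]^d,\mathbb{R}^m),\ \|g-f\|_{\mathcal{C}^1}\le\varepsilon\right\},$$ where $\mathcal{H}^{d-1}$ is the $(d-1)$-dimensional Hausdorff measure and $\|h\|_{\mathcal{C}^1}=\sup_{x\in[0,1]^d}|h(x)|+\sup_{x\in[0,1]^d}|Dh(x)|$, with $|\cdot|$ the Euclidean norm on vectors and the operator norm on matrices. The minimal modulus of continuity of $Df$ is $\omega_{Df}(0)=0$ and $$\omega_{Df}(\delta)=\sup\{|Df(y)-Df(x)|: x,y\in[0,1]^d,\ |x-y|\le\delta\},\qquad\delta>0.$$ For $\delta\ge0$ define $$\beta_f(\delta)=\omega_{Df}\big(\sqrt d\,\delta\big)\cdot\left[1+\sqrt d\,\delta+4d^{\,d+\frac12}(d+1)^4\right].$$ $\beta_f^{-1}$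 denotes the inverse of the map $\beta_f:[0,\infty)\to[0,\infty)$, i.e. $\beta_f^{-1}(\varepsilon)=\sup\{\delta\ge0:\beta_f(\delta)\le\varepsilon\}$. When $Df$ is non-constant, $\beta_f$ is strictly increasing and this is its ordinary inverse. When $Df$ is constant, $\beta_f\equiv0$, $\beta_f^{-1}(\varepsilon)=+\infty$, and $1/\beta_f^{-1}(\varepsilon)$ is read as $0$. *)

(* Defs.v *)
From HB Require Import structures.
From mathcomp Require Import all_boot all_order all_algebra.
From mathcomp Require Import all_classical all_reals all_analysis.

Set Implicit Arguments.
Unset Strict Implicit.
Unset Printing Implicit Defensive.

Import Order.TTheory GRing.Theory Num.Theory.
Import numFieldNormedType.Exports.

Local Open Scope classical_set_scope.
Local Open Scope ring_scope.

(* The norm `|x| of the library on matrices is the max norm, hence enorm. *)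
Definition enorm (R : realType) (n : nat) (u : 'rV[R]_n) : R :=
  Num.sqrt (\sum_(i < n) u ord0 i ^+ 2).

(* Points are row vectors and A acts by v |-> v *m A, the convention of the
   library for 'J; 'J f x is thus the transpose of the usual m x d Jacobian
   matrix, which changes neither its rank nor its operator norm. *)
Definition opnorm (R : realType) (n p : nat) (A : 'M[R]_(n, p)) : R :=
  sup [set enorm (v *m A) | v in [set v : 'rV[R]_n | enorm v <= 1]].

Definition cube (R : realType) (d : nat) : set 'rV[R]_d :=
  [set x | forall i, 0 <= x ord0 i <= 1].

Definition open_cube (R : realType) (d : nat) : set 'rV[R]_d :=
  [set x | forall i, 0 < x ord0 i < 1].

Arguments cube {R} d _.
Arguments open_cube {R} d _.

(* A function on the closed cube is a function on the whole space of which only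
   the restriction to the cube matters. It is C^1 on the closed cube when it is
   continuous there and its Jacobian on the open cube extends continuously to
   the closed cube. *)
Definition C1_cube (R : realType) (d m : nat) (f : 'rV[R]_d -> 'rV[R]_m) : Prop :=
  {within cube d, continuous f} /\
  exists Df : 'rV[R]_d -> 'M[R]_(d, m),
    {within cube d, continuous Df} /\
    (forall x, open_cube d x -> differentiable f x /\ 'J f x = Df x).

(* The continuous extension of the Jacobian to the closed cube. *)
Definition Dcube (R : realType) (d m : nat) (f : 'rV[R]_d -> 'rV[R]_m)
    (x : 'rV[R]_d) : 'M[R]_(d, m) :=
  lim ('J f y @[y --> within (open_cube d) (nbhs x)]).

Definition C1norm (R : realType) (d m : nat) (h : 'rV[R]_d -> 'rV[R]_m) : \bar R :=
  (ereal_sup [set (enorm (h x))%:E | x in cube d] +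
   ereal_sup [set (opnorm (Dcube h x))%:E | x in cube d])%E.

Definition critical_set (R : realType) (d m : nat) (g : 'rV[R]_d -> 'rV[R]_m) :
    set 'rV[R]_d :=
  [set x | open_cube d x /\ (\rank ('J g x) <= m - 1)%N].

Definition diam (R : realType) (n : nat) (U : set 'rV[R]_n) : \bar R :=
  ereal_sup [set e | exists x y, [/\ U x, U y & e = (enorm (x - y))%:E]].

(* The volume pi^(n/2) / Gamma(n/2 + 1) of the Euclidean unit ball of R^n. *)
Fixpoint ball_volume (R : realType) (n : nat) : R :=
  match n with
  | 0 => 1
  | 1 => 2
  | n'.+2 => 2 * pi / n%:R * ball_volume R n'
  end.

(* The test for the empty set matters for s = 0, where diam(U)^0 must be read
   as 0 if U is empty and as 1 otherwise. *)
Definition hausdorff_gauge (R : realType) (n s : nat) (U : set 'rV[R]_n) : \bar R :=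
  if U == set0 then 0%E
  else ((ball_volume R s)%:E * ((2^-1)%R%:E * diam U) ^+ s)%E.

Definition hausdorff_delta (R : realType) (n s : nat) (delta : R)
    (A : set 'rV[R]_n) : \bar R :=
  ereal_inf [set (\sum_(0 <= i <oo) hausdorff_gauge s (U i))%E |
    U in [set U : nat -> set 'rV[R]_n |
      A `<=` \bigcup_i U i /\ forall i, (diam (U i) <= delta%:E)%E]].

(* Normalized so that the s-dimensional measure is Lebesgue measure on R^s
   (counting measure if s = 0). *)
Definition hausdorff_measure (R : realType) (n s : nat) (A : set 'rV[R]_n) : \bar R :=
  ereal_sup [set hausdorff_delta s delta A | delta in [set delta : R | 0 < delta]].

Definition Ncrit (R : realType) (d m : nat) (f : 'rV[R]_d -> 'rV[R]_m) (eps : R) :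
    \bar R :=
  ereal_inf [set hausdorff_measure (d - 1) (critical_set g) |
    g in [set g : 'rV[R]_d -> 'rV[R]_m |
      C1_cube g /\ (C1norm (fun x => g x - f x)%R <= eps%:E)%E]].

Definition omegaD (R : realType) (d m : nat) (f : 'rV[R]_d -> 'rV[R]_m) (delta : R) :
    \bar R :=
  if 0 < delta then
    ereal_sup [set e | exists x y, [/\ cube d x, cube d y, enorm (x - y) <= delta &
      e = (opnorm (Dcube f y - Dcube f x))%:E]]
  else 0%E.

Definition beta (R : realType) (d m : nat) (f : 'rV[R]_d -> 'rV[R]_m) (delta : R) :
    \bar R :=
  (omegaD f (Num.sqrt d%:R * delta)%R *
   (1 + Num.sqrt d%:R * delta
    + 4 * (d%:R `^ (d%:R + 2^-1)) * (d%:R + 1) ^+ 4)%R%:E)%E.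

Definition beta_inv (R : realType) (d m : nat) (f : 'rV[R]_d -> 'rV[R]_m) (eps : R) :
    \bar R :=
  ereal_sup [set delta%:E | delta in
    [set delta : R | 0 <= delta /\ (beta f delta <= eps%:E)%E]].

(* Main.v *)
Require Import Defs.
From HB Require Import structures.
From mathcomp Require Import all_boot all_order all_algebra.
From mathcomp Require Import all_classical all_reals all_analysis.
From mathcomp Require Import measurable_realfun ring lra zify.

Set Implicit Arguments.
Unset Strict Implicit.
Unset Printing Implicit Defensive.

Import Order.TTheory GRing.Theory Num.Theory.
Import numFieldNormedType.Exports.

Local Open Scope classical_set_scope.
Local Open Scope ring_scope.

(* Fix delta with beta_f(delta) <= eps and put om = eps / (1 + sqrt d delta + K)
   with K = 4 d^(d + 1/2) (d + 1)^4, so that Df oscillates by at most om at scale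
   delta. Blending the Taylor polynomials of f at the nodes of a grid of mesh
   about delta gives g0 at C^1 distance O(om) of f with Dg0 Lipschitz of constant
   O(om / delta). The map g = g0 + B, with B linear of size T comparable to K om,
   is the required one for a suitable B, found by averaging instead of a
   genericity argument. Cut the cube into boxes of side h. A box can only meet
   the critical set of g if an m x m minor of Dg0 + B at its corner is O(om h /
   delta)-close to a singular matrix; along each line of matrices on which a
   single entry varies this has probability O(om h / (delta T)). So on average
   h^(d-1) times the number of boxes that meet the critical set is O(om / (delta
   T)), and by Fatou's lemma some B achieves such a bound for arbitrarily small
   h. As T is comparable to K om, the Hausdorff measure is O(1 / (K delta)). *)

(** * Matrices close to singular ones *)

(** Averaging yields a separate B for every h, whereas a single g must be good at infinitely many h,
    since the Hausdorff measure is a limit over ever finer covers; this is what Fatou's lemma is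
    for. It is applied to one entry of B at a time, on [0, 1), so that no measure on a space of
    matrices is required, and finite grids turn probabilities into counts. A hit must have
    probability linear in h, because of the h^(-d) boxes only h^(1-d) may remain; hence nearness to
    singular matrices is measured by the size of a perturbation and not by the determinant.
    Smoothing is needed because Df is merely continuous and has no Lipschitz bound below the scale
    delta. The powers of d in K serve twice: they pay for the C^1 error of the smoothing, and d^d
    pays for the factor sqrt d^(d-1) that comes from the diameters of the boxes. For m < d one minor
    is enough, as the critical set only has to be enclosed in its zero set. *)

Lemma normalize_max (R : realFieldType) (n : nat) (v : 'rV[R]_n) : v != 0 ->
  exists j, exists2 w : 'rV[R]_n, (exists k : R, w = k *: v) &
    w 0 j = 1 /\ forall i, `|w 0 i| <= 1.
Proof.
move=> v0.
have [i0 vi0] : exists i, v 0 i != 0.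
  apply/existsP; apply: contraT; rewrite negb_exists => /forallP h.
  case/eqP: v0; apply/rowP => i; rewrite mxE; apply/eqP.
  by move: (h i); rewrite negbK.
pose j := [arg max_(i > i0) `|v 0 i|]%O.
have jP i : `|v 0 i| <= `|v 0 j|.
  by rewrite /j; case: arg_maxP => //= k _; exact.
have vj0 : v 0 j != 0 by rewrite -normr_gt0 (lt_le_trans _ (jP i0))// normr_gt0.
exists j, ((v 0 j)^-1 *: v); first by exists (v 0 j)^-1.
split=> [|i]; first by rewrite mxE mulVf.
by rewrite mxE normrM normfV ler_pdivrMl ?normr_gt0// mulr1.
Qed.

Lemma mulmx_entry_le (R : realFieldType) (a b c : nat) (A : 'M[R]_(a, b)) (B : 'M[R]_(b, c))
    (x y : R) : 0 <= x ->
  (forall i j, `|A i j| <= x) -> (forall i j, `|B i j| <= y) ->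
  forall i j, `|(A *m B) i j| <= b%:R * (x * y).
Proof.
move=> x0 Ax By i j; rewrite mxE (le_trans (ler_norm_sum _ _ _))//.
rewrite (le_trans (ler_sum _ (G := fun=> x * y) _))//.
  by move=> k _; rewrite normrM ler_pM.
by rewrite sumr_const card_ord mulr_natl.
Qed.

Section near_singular.
Variables (R : realFieldType) (m : nat).
Implicit Types (M E : 'M[R]_m) (i j : 'I_m).

(** Stated through a perturbation so that singularity at a point of a box passes to the corner by
    the triangle inequality. *)
Definition near_singular (rho : R) M : Prop :=
  exists2 E : 'M[R]_m, (forall i j, `|E i j| <= rho) & \det (M + E) = 0.

(* [n] is orthogonal to the columns of [M] other than [j] and [v] is in the
   kernel of a perturbation of [M]; both have sup norm 1, reached at [i] and
   [j]. *)
Definition near_singular_at (rho : R) i j M : Prop :=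
  exists n : 'rV[R]_m, exists v : 'cV[R]_m, exists E : 'M[R]_m,
  [/\ n 0 i = 1, (forall k, `|n 0 k| <= 1), v j 0 = 1,
      (forall k, `|v k 0| <= 1) &
    [/\ (forall k, k != j -> (n *m M) 0 k = 0),
      (forall i j, `|E i j| <= rho) & (M + E) *m v = 0]].

Lemma near_singular_at_ex rho M : near_singular rho M ->
  exists i j, near_singular_at rho i j M.
Proof.
move=> [E Eb dE].
have : \det (M + E)^T == 0 by rewrite det_tr dE.
case/det0P => v v0 vE.
have [j [w [k wE] [wj wb]]] := normalize_max v0.
(* The kernel vector has fixed the column [j]. With this column set to 0 the matrix is singular, and
   a left kernel vector is orthogonal to all the other columns; its largest entry fixes the row
   [i]. *)
pose M' := \matrix_(a, b) (if b == j then 0 else M a b) : 'M[R]_m.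
have dM' : \det M' == 0.
  rewrite (expand_det_col M' j) big1// => a _.
  by rewrite mxE eqxx mul0r.
case/det0P : dM' => u u0 uM'.
have [i [n [k' nE] [ni nb]]] := normalize_max u0.
exists i, j, n, w^T, E; split => //.
- by rewrite mxE.
- by move=> l; rewrite mxE.
split => //.
- move=> l lj; rewrite nE -scalemxAl mxE.
  have -> : (u *m M) 0 l = (u *m M') 0 l.
    by rewrite !mxE; apply: eq_bigr => a _; rewrite !mxE (negbTE lj).
  by rewrite uM' mxE mulr0.
- by rewrite wE -[M + E]trmxK -trmx_mul -scalemxAl vE scaler0 trmx0.
Qed.

(* If the entry (i, j) is the only one to vary, then [(n *m M) 0 j] determines
   it, and this number is [- (n *m E *m v)], which is small. *)
Lemma near_singular_at_width rho i j M M' (t : R) : 0 <= rho ->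
  near_singular_at rho i j M -> near_singular_at rho i j M' ->
  M' = M + t *: delta_mx i j -> `|t| <= 2 * m%:R ^+ 2 * rho.
Proof.
move=> rho0 [n [v [E [ni nb vj vb [nM Eb MEv]]]]].
move=> [_ [v' [E' [_ _ v'j v'b [_ E'b MEv']]]]] M'E.
have key (N F : 'M[R]_m) (w : 'cV[R]_m) : w j 0 = 1 ->
    (forall k, `|w k 0| <= 1) -> (forall i j, `|F i j| <= rho) ->
    (forall k, k != j -> (n *m N) 0 k = 0) -> (N + F) *m w = 0 ->
    `|(n *m N) 0 j| <= m%:R ^+ 2 * rho.
  move=> wj wb Fb nN NFw.
  have -> : (n *m N) 0 j = (n *m N *m w) 0 0.
    rewrite [RHS]mxE (bigD1 j)//= wj mulr1.
    by rewrite big1 ?addr0// => k kj; rewrite nN// mul0r.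
  have -> : n *m N *m w = - (n *m (F *m w)).
    apply/eqP; rewrite -addr_eq0 -mulmxA -mulmxDr -mulmxDl NFw mulmx0//.
  rewrite mxE normrN.
  have Fw : forall a b, `|(F *m w) a b| <= m%:R * (rho * 1).
    by apply: mulmx_entry_le => // a b; rewrite ord1.
  have := @mulmx_entry_le _ _ _ _ n (F *m w) 1 _ ler01 _ Fw 0 0.
  rewrite mulr1 mul1r mulrA -expr2; apply=> a b.
  by rewrite ord1.
have h1 := key _ _ _ vj vb Eb nM MEv.
(* [M] and [M'] differ only in column [j], so the vector [n] of [M] serves for both and that of [M']
   can be discarded. *)
have nM' k : k != j -> (n *m M') 0 k = 0.
  move=> kj; rewrite -(nM k kj) M'E !mxE; apply: eq_bigr => a _.
  by rewrite !mxE (negbTE kj) andbF mulr0 addr0.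
have := key _ _ _ v'j v'b E'b nM' MEv'.
suff -> : (n *m M') 0 j = (n *m M) 0 j + t.
  move=> h2; have -> : t = ((n *m M) 0 j + t) - (n *m M) 0 j.
    by rewrite addrAC subrr add0r.
  rewrite (le_trans (ler_normB _ _))// -mulrA mulr_natl mulr2n lerD//.
rewrite M'E !mxE.
transitivity (\sum_k (n 0 k * M k j + (k == i)%:R * t)).
  apply: eq_bigr => k _; rewrite !mxE eqxx andbT.
  by case: eqVneq => [->|_]; rewrite ?ni mulrDr ?mulr1 ?mul1r ?mulr0 ?mul0r.
rewrite big_split/=; congr (_ + _).
rewrite (bigD1 i)//= eqxx mul1r big1 ?addr0// => k /negbTE ->.
by rewrite mul0r.
Qed.

End near_singular.

Lemma rank_near_singular (R : realFieldType) (d m : nat) (J : 'M[R]_(d, m))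
    (top : 'I_m -> 'I_d) :
  (0 < m)%N -> (\rank J <= m - 1)%N -> \det (rowsub top J) = 0.
Proof.
move=> m0 rJ; apply/eqP; apply: contraT => dJ.
have : rowsub top J \in unitmx by rewrite unitmxE unitfE.
rewrite -row_free_unit /row_free => /eqP rk.
have : (\rank (rowsub top J) <= \rank J)%N by apply: mxrankS; exact: rowsub_sub.
by rewrite rk; move: rJ m0; lia.
Qed.

(** * Averages over finite grids *)

(** All hits lie between the least one, s, and s + W; the summand 1 counts both ends of this window
    of integers. *)
Lemma sum_close_le (R : archiRealFieldType) (D : nat) (P : pred nat) (W : R) :
  0 <= W ->
  (forall s t : nat, (s < D)%N -> (t < D)%N -> P s -> P t ->
    t%:R - s%:R <= W) ->
  \sum_(t < D) (P t)%:R <= W + 1.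
Proof.
move=> W0 PW.
have -> : \sum_(t < D) (P t)%:R = (size [seq t <- iota 0 D | P t])%:R :> R.
  rewrite size_filter -(big_mkord xpredT (fun t => (P t)%:R)) /index_iota subn0.
  by elim: (iota 0 D) => [|a s IH]; rewrite ?big_nil// big_cons IH /= natrD.
have [->|[t0 t0P]] : [seq t <- iota 0 D | P t] = [::] \/
    exists t0, t0 \in [seq t <- iota 0 D | P t].
  by case: [seq t <- iota 0 D | P t] => [|a s]; [left|right; exists a; rewrite mem_head].
  by rewrite addr_ge0.
have ex : exists t, (t < D)%N && P t.
  by exists t0; move: t0P; rewrite mem_filter mem_iota /= add0n andbC.
case: (ex_minnP ex) => s /andP[sD Ps] smin.
have : {subset [seq t <- iota 0 D | P t] <= iota s (Num.truncn W).+1}.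
  move=> t; rewrite mem_filter !mem_iota /= add0n => /andP[Pt tD].
  have st : (s <= t)%N by apply: smin; rewrite tD.
  rewrite st /= addnS ltnS -leq_subLR -(@ler_nat R) ?truncn_ge_nat//.
  by rewrite ler_nat truncn_ge_nat// natrB// PW.
move/(uniq_leq_size (filter_uniq _ (iota_uniq _ _))).
rewrite size_iota -(ler_nat R) => /le_trans; apply.
by rewrite -natr1 lerD2r truncn_le.
Qed.

Section average.
Variable R : realFieldType.
Implicit Types (X Y : (nat -> nat) -> R) (p : nat -> nat).

Definition upd (k a : nat) (p : nat -> nat) : nat -> nat :=
  fun i => if i == k then a else p i.

(** The mean over {0, ..., D - 1}^q, written as iterated means so that Fatou's lemma can act on one
    coordinate at a time. The index [p] is a total function, 0 from [q] on, so that its type does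
    not depend on [q]. *)
Fixpoint average (D q : nat) X : R :=
  if q is q'.+1 then
    D%:R^-1 * \sum_(a < D) average D q' (fun p => X (upd q' a p))
  else X (fun=> 0%N).

Lemma le_average D q X Y : (forall p, X p <= Y p) ->
  average D q X <= average D q Y.
Proof.
elim: q X Y => [|q IH] X Y XY //=.
by rewrite ler_wpM2l ?invr_ge0// ler_sum// => a _; apply: IH.
Qed.

Lemma average_sum D q (I : Type) (r : seq I) (F : I -> (nat -> nat) -> R) :
  average D q (fun p => \sum_(i <- r) F i p) = \sum_(i <- r) average D q (F i).
Proof.
elim: q F => [|q IH] F //=.
under eq_bigr do rewrite IH.
by rewrite exchange_big/= mulr_sumr.
Qed.

Lemma averageZ D q (c : R) X :
  average D q (fun p => c * X p) = c * average D q X.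
Proof.
elim: q X => [|q IH] X //=.
by under eq_bigr do rewrite IH; rewrite -mulr_sumr mulrCA.
Qed.

Lemma average_cst D q (c : R) : (0 < D)%N -> average D q (fun=> c) = c.
Proof.
move=> D0; elim: q => [//|q IH] /=.
rewrite IH sumr_const card_ord -[c *+ D]mulr_natl mulrA mulVf ?mul1r//.
by rewrite pnatr_eq0 -lt0n.
Qed.

(** Means commute, so the one over coordinate [k] may be taken first; the induction peels off the
    outer coordinates until [k] is the outermost. *)
Lemma average_line_le D q (k : nat) X (W : R) : (0 < D)%N -> (k < q)%N ->
  (forall p, \sum_(t < D) X (upd k t p) <= W) -> average D q X <= W / D%:R.
Proof.
move=> D0; elim: q X => [//|q IH] X; rewrite ltnS leq_eqVlt => /orP[/eqP->|kq] XW /=.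
  rewrite -average_sum -averageZ -[leRHS](@average_cst D q _ D0).
  by apply: le_average => p; rewrite mulrC ler_wpM2r ?invr_ge0.
rewrite -[leRHS](@average_cst D q.+1 _ D0)/= ler_wpM2l ?invr_ge0// ler_sum// => a _.
rewrite average_cst//; apply: IH => // p.
rewrite (le_trans _ (XW (upd q a p)))// ler_sum// => t _.
rewrite le_eqVlt; apply/orP; left; apply/eqP; congr X.
apply/funext => i; rewrite /upd; case: (eqVneq i q) => // ->.
by rewrite gtn_eqF.
Qed.

End average.

(** * A Fatou lemma for iterated averages *)

Section reverse_fatou.
Variable R : realType.

(** Turns a mean over a grid into an integral over the fixed interval [0, 1), where grids with
    different [D] can be compared. *)
Definition step_fun (D : nat) (F : nat -> R) (t : R) : \bar R :=
  (\sum_(k < D) (F k * \1_(`[k%:R / D%:R, k.+1%:R / D%:R[%classic : set R) t)%:E)%E.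

Lemma step_funE D F t (a : nat) : (0 < D)%N -> (a < D)%N ->
  a%:R <= D%:R * t < a.+1%:R -> step_fun D F t = (F a)%:E.
Proof.
move=> D0 aD /andP[at1 at2].
have D0' : 0 < D%:R :> R by rewrite ltr0n.
rewrite /step_fun (bigD1 (Ordinal aD))//= big1 ?adde0 => [|k kj].
  rewrite indicE mem_set ?mulr1//= in_itv/=.
  by rewrite ler_pdivrMr// ltr_pdivlMr// mulrC at1 at2.
rewrite indicE memNset ?mulr0//= in_itv/= ler_pdivrMr// ltr_pdivlMr// mulrC.
move=> /andP[k1 k2]; case/eqP: kj; apply/val_inj => /=; apply/eqP.
have : (k%:R < a.+1%:R :> R) by apply: le_lt_trans at2.
have : (a%:R < k.+1%:R :> R) by apply: le_lt_trans k2.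
by rewrite !ltr_nat !ltnS eqn_leq => -> ->.
Qed.

Lemma measurable_step_fun (E : set R) D F : measurable_fun E (step_fun D F).
Proof.
apply: emeasurable_sum => k.
apply/measurable_EFinP; exact: measurable_funM.
Qed.

Lemma integral_step_fun D F : (0 < D)%N -> (forall k, 0 <= F k) ->
  (\int[lebesgue_measure]_(t in `[0%R, 1%R[) step_fun D F t =
    (D%:R^-1 * \sum_(k < D) F k)%:E)%E.
Proof.
move=> D0 F0.
have D0' : 0 < D%:R :> R by rewrite ltr0n.
rewrite ge0_integral_sum//=; last 2 first.
- move=> k; apply/measurable_EFinP; exact: measurable_funM.
- by move=> k t _; rewrite lee_fin mulr_ge0// indicE.
rewrite mulr_sumr -sumEFin; apply: eq_bigr => k _.
under eq_integral do rewrite EFinM.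
rewrite ge0_integralZl_EFin//; last first.
  by apply/measurable_EFinP; exact: measurable_indic.
rewrite integral_indic// [in RHS]mulrC EFinM; congr (_ * _)%E.
rewrite setIidl; last first.
  move=> t /=; rewrite !in_itv/= => /andP[t1 t2]; apply/andP; split.
    by apply: le_trans t1; rewrite divr_ge0.
  by apply: lt_le_trans t2 _; rewrite ler_pdivrMr// mul1r ler_nat.
apply: etrans (lebesgue_measure_itv _) _; rewrite /= lte_fin ltr_pM2r ?invr_gt0// ltr_nat ltnSn.
by rewrite -EFinB -mulrBl -natr1 addrAC subrr add0r mul1r.
Qed.

(** If no [t] worked, then at every [t] the step functions would eventually be at least A', and so
    would their lower limit; its integral would be at least A', while Fatou's lemma bounds it by A.
    The gap A < A' is what lets one [t] serve infinitely many [l]. *)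
Lemma reverse_fatou (D : nat -> nat) (F : nat -> nat -> R) (A A' : R) :
  (forall l, (0 < D l)%N) -> (forall l k, 0 <= F l k) ->
  (forall l, (D l)%:R^-1 * \sum_(k < D l) F l k <= A) -> A < A' ->
  exists2 t : R, 0 <= t < 1 & forall l0, exists2 l, (l0 <= l)%N &
    exists a, [/\ (a < D l)%N, a%:R <= (D l)%:R * t < a.+1%:R & F l a <= A'].
Proof.
move=> D0 F0 FA AA'; apply: contrapT => nex.
have A0 : 0 <= A.
  by apply: le_trans (FA 0%N); rewrite mulr_ge0 ?invr_ge0// sumr_ge0.
pose I : set R := [set` `[0%R, 1%R[].
pose S l := step_fun (D l) (F l).
have S0 l t : I t -> (0 <= S l t)%E.
  by move=> _; apply: sume_ge0 => k _; rewrite lee_fin mulr_ge0// indicE.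
have lb t : I t -> (A'%:E <= limn_einf (S ^~ t))%E.
  rewrite /I /= in_itv/= => /andP[t0 t1].
  have [l0 l0P] : exists l0, forall l, (l0 <= l)%N -> (A'%:E <= S l t)%E.
    apply: contrapT => nl; apply: nex; exists t; first by rewrite t0.
    move=> l0; have /existsNP[l /not_implyP[l0l /negP]] :
      ~ forall l, (l0 <= l)%N -> (A'%:E <= S l t)%E by move=> h; apply: nl; exists l0.
    rewrite -ltNge => Slt; exists l => //; exists (Num.truncn ((D l)%:R * t)).
    have Dl0 : 0 < (D l)%:R :> R by rewrite ltr0n.
    have ha : (Num.truncn ((D l)%:R * t))%:R <= (D l)%:R * t <
        (Num.truncn ((D l)%:R * t)).+1%:R.
      by rewrite truncn_le mulr_ge0 ?truncnS_gt//; exact: ltW.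
    have aD : (Num.truncn ((D l)%:R * t) < D l)%N.
      rewrite -(ltr_nat R); case/andP: ha => ha _; apply: le_lt_trans ha _.
      by rewrite -[ltRHS]mulr1 ltr_pM2l.
    split => //; move: Slt; rewrite /S (step_funE _ (D0 l) aD)// lte_fin.
    exact: ltW.
  rewrite limn_einf_lim (cvg_lim _ (@cvg_einfs_sup _ _))//.
  apply: le_trans (ereal_sup_ubound _); last by exists l0.
  by apply: le_ereal_inf_tmp => _ [l /= l0l <-]; exact: l0P.
have mI : measurable I by exact: measurable_itv.
have := @fatou _ _ R lebesgue_measure I mI S
  (fun l => @measurable_step_fun I (D l) (F l)) S0.
apply/negP; rewrite -ltNge.
have ub : (limn_einf (fun n => \int[lebesgue_measure]_(x in I) S n x) <= A%:E)%E.
  rewrite limn_einf_lim (cvg_lim _ (@cvg_einfs_sup _ _))//.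
  apply: ge_ereal_sup => _ [l _ <-].
  rewrite (@le_trans _ _ (\int[lebesgue_measure]_(x in I) S l x)%E)//.
    by apply: ereal_inf_lbound; exists l => /=.
  by rewrite integral_step_fun// lee_fin.
apply: le_lt_trans ub _.
apply: (@lt_le_trans _ _ (\int[lebesgue_measure]_(x in I) (cst A'%:E) x)%E).
  rewrite integral_cst//= lebesgue_measure_itv/= lte_fin ltr01 oppr0 adde0 mule1.
  by rewrite lte_fin.
apply: ge0_le_integral => //.
- by move=> x _; rewrite lee_fin (le_trans A0)// ltW.
- rewrite /limn_einf; apply: measurableT_comp => //.
  apply: (@measurable_fun_limn_esup _ _ _ _ (fun n x => - S n x)%E) => n.
  by apply: measurableT_comp => //; exact: measurable_step_fun.
Qed.

(** Induction on the number of coordinates: the one-dimensional lemma freezes the outermost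
    coordinate and leaves infinitely many good [l], on which the induction hypothesis is run. Each
    round needs a strict gap, hence [A1] between A and A'. *)
Lemma reverse_fatou_average (q : nat) (D : nat -> nat)
    (X : nat -> (nat -> nat) -> R) (A A' : R) :
  (forall l, (0 < D l)%N) -> (forall l p, 0 <= X l p) ->
  (forall l, average (D l) q (X l) <= A) -> A < A' ->
  exists2 b : nat -> R, (forall k, 0 <= b k < 1) &
    forall l0, exists2 l, (l0 <= l)%N &
      exists2 p : nat -> nat,
        forall k, (k < q)%N -> (p k)%:R <= (D l)%:R * b k < (p k).+1%:R &
        X l p <= A'.
Proof.
elim: q D X A => [|q IH] D X A D0 X0 XA AA'.
  exists (fun=> 0) => [k|l0]; first by rewrite lexx ltr01.
  by exists l0 => //; exists (fun=> 0%N) => //; rewrite (le_trans (XA _))// ltW.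
have [A1 AA1 A1A'] : exists2 A1, A < A1 & A1 < A'.
  by exists ((A + A') / 2); rewrite (midf_lt AA').
have [|t t01 ht] := @reverse_fatou D
    (fun l a => average (D l) q (fun p => X l (upd q a p))) A A1 D0 _ XA AA1.
  move=> l k; apply: (@le_trans _ _ (average (D l) q (fun=> 0))).
    by rewrite average_cst.
  exact: le_average.
pose good l a := [/\ (a < D l)%N, a%:R <= (D l)%:R * t < a.+1%:R &
  average (D l) q (fun p => X l (upd q a p)) <= A1].
(* The subsequence need not be increasing: an index at least [l0] for each [l0] is all that the
   conclusion asks for. *)
have /choice[phi phiP] : forall l0, exists la : nat * nat,
    (l0 <= la.1)%N /\ good la.1 la.2.
  by move=> l0; have [l l0l [a ga]] := ht l0; exists (l, a).
have [|||b b01 bP] := IH (fun l => D (phi l).1)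
    (fun l p => X (phi l).1 (upd q (phi l).2 p)) A1 _ _ _ A1A'.
- by [].
- by [].
- by move=> l; case: (phiP l) => _ [].
exists (fun k => if k == q then t else b k) => [k|l0]; first by case: eqP.
have [l l0l [p pb pA]] := bP l0; have [lphi [_ phit _]] := phiP l.
exists (phi l).1; first exact: leq_trans lphi.
exists (upd q (phi l).2 p) => // k; rewrite /upd ltnS leq_eqVlt.
by case: eqVneq => //= _; exact: pb.
Qed.

End reverse_fatou.

(** * Choice of the perturbation *)

Definition in_box (R : numDomainType) (d N : nat) (c : {ffun 'I_d -> 'I_N})
    (x : 'rV[R]_d) : Prop :=
  forall i, (c i)%:R <= N%:R * x 0 i <= (c i).+1%:R.

Definition corner (R : fieldType) (d N : nat) (c : {ffun 'I_d -> 'I_N}) :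
    'rV[R]_d := \row_i ((c i)%:R / N%:R).

Lemma in_box_corner (R : realFieldType) (d N : nat) (c : {ffun 'I_d -> 'I_N}) :
  (0 < N)%N -> in_box c (corner R c).
Proof.
move=> N0 i; rewrite mxE mulrC divfK ?pnatr_eq0 -?lt0n//.
by rewrite lexx ler_nat leqnSn.
Qed.

Lemma in_box_ex (R : archiRealFieldType) (d N : nat) (x : 'rV[R]_d) : (0 < N)%N ->
  (forall i, 0 <= x 0 i <= 1) -> exists c : {ffun 'I_d -> 'I_N}, in_box c x.
Proof.
move=> N0 x01.
have hi i : exists c : 'I_N, c%:R <= N%:R * x 0 i <= c.+1%:R.
  have /andP[x0 x1] := x01 i.
  (* At the right end the integer part is N, which indexes no box; the last box is closed and
     contains this point. *)
  have [e|lt1] := eqVneq (x 0 i) 1.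
    have N1 : (N.-1 < N)%N by rewrite prednK.
    exists (Ordinal N1) => /=.
    by rewrite e mulr1 !ler_nat prednK// leq_pred leqnn.
  have Nx0 : 0 <= N%:R * x 0 i by rewrite mulr_ge0.
  have h : (Num.truncn (N%:R * x 0 i)%R < N)%N.
    by rewrite truncn_lt_nat// -[ltRHS]mulr1 ltr_pM2l ?ltr0n// lt_neqAle lt1.
  exists (Ordinal h) => /=.
  by have /andP[-> /ltW] := truncn_itv Nx0.
have /choice[c cP] := hi.
by exists [ffun i => c i] => i; rewrite ffunE.
Qed.

Section good_perturbation.
Variables (R : realType) (d m n : nat) (T Lam : R) (M : 'rV[R]_d -> 'M[R]_m).
Hypotheses (d0 : (0 < d)%N) (m0 : (0 < m)%N) (n0 : (0 < n)%N) (T0 : 0 < T) (Lam0 : 0 < Lam).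
(** Multiples of the smoothing mesh number n: every small box then lies in a single cell of the
    smoothing grid, where the Lipschitz estimate holds. *)
Let N l := (n * l.+1)%N.
Hypothesis Mlip : forall l (c : {ffun 'I_d -> 'I_(N l)}) x, in_box c x ->
  forall i j, `|M x i j - M (corner R c) i j| <= Lam / (N l)%:R.

Let index (i j : 'I_m) : nat := (i * m + j)%N.

Let index_inj i j i' j' : index i j = index i' j' -> i = i' /\ j = j'.
Proof.
rewrite /index => e.
have ei : (i : nat) = i'.
  by move: (congr1 (divn^~ m) e); rewrite !divnMDl// !divn_small// !addn0.
split; apply/val_inj => //=; apply/eqP.
by rewrite -(eqn_add2l (i * m)) e ei.
Qed.

Let index_lt i j : (index i j < m * m)%N.
Proof.
by rewrite /index -ltn_subRL; have := ltn_ord i; have := ltn_ord j; nia.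
Qed.

Let B (D : nat) (p : nat -> nat) : 'M[R]_m :=
  \matrix_(i, j) (T * ((p (index i j))%:R / D%:R) - T / 2).

(** Union bound over the m^2 pairs (i, j). When only the entry (i, j) moves, two hits differ there
    by at most 2 m^2 rho, that is, by 2 m^2 rho / (T / D) grid steps; the term 1 / D is the rounding
    of this count. *)
Let average_near_singular (D : nat) (rho : R) (Mc : 'M[R]_m) : (0 < D)%N ->
  0 <= rho ->
  average D (m * m) (fun p => `[< near_singular rho (Mc + B D p) >]%:R : R) <=
  m%:R ^+ 2 * (2 * m%:R ^+ 2 * rho / T + D%:R^-1).
Proof.
move=> D0 rho0.
have D0' : 0 < D%:R :> R by rewrite ltr0n.
pose Y (a : 'I_m * 'I_m) p : R :=
  `[< near_singular_at rho a.1 a.2 (Mc + B D p) >]%:R.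
apply: (@le_trans _ _ (average D (m * m) (fun p => \sum_a Y a p))).
  apply: le_average => p; have [ns|_] := asboolP; last by rewrite sumr_ge0.
  have [i [j nij]] := near_singular_at_ex ns.
  rewrite (bigD1 (i, j))//= /Y asboolT//= lerDl sumr_ge0//.
rewrite average_sum.
apply: (@le_trans _ _ (\sum_(a : 'I_m * 'I_m)
    (2 * m%:R ^+ 2 * rho / (T / D%:R) + 1) / D%:R)); last first.
  rewrite sumr_const card_prod card_ord -[leLHS]mulr_natl natrM -expr2.
  rewrite ler_wpM2l// le_eqVlt; apply/orP; left; apply/eqP.
  by field; rewrite !gt_eqF.
apply: ler_sum => -[i j] _.
apply: (average_line_le D0 (index_lt i j)) => p.
apply: (sum_close_le (P := fun t => `[< near_singular_at rho i j
   (Mc + B D (upd (index i j) t p)) >])).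
  by rewrite divr_ge0 ?divr_ge0 ?mulr_ge0// ltW.
move=> s t _ _ /asboolP hs /asboolP ht.
have /(near_singular_at_width rho0 hs ht) : Mc + B D (upd (index i j) t p) =
    Mc + B D (upd (index i j) s p) + (T / D%:R * (t%:R - s%:R)) *: delta_mx i j.
  rewrite -addrA; congr (_ + _); apply/matrixP => a b; rewrite !mxE /upd.
  case: eqP => [/index_inj[-> ->]|/eqP ne].
    by rewrite !eqxx mulr1; ring.
  have -> : (a == i) && (b == j) = false.
    by apply: contra_neqF ne => /andP[/eqP -> /eqP ->].
  by rewrite mulr0 addr0.
move=> h; rewrite ler_pdivlMr ?divr_gt0// (le_trans _ h)// mulrC.
exact: ler_norm.
Qed.

Lemma good_perturbation_ex (A : R) :
  5 / 2 * m%:R ^+ 4 * Lam / T < A ->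
  exists2 B : 'M[R]_m, (forall i j, `|B i j| <= T / 2) &
    forall l0, exists2 l, (l0 <= l)%N &
      exists2 S : {set {ffun 'I_d -> 'I_(N l)}},
        #|S|%:R <= A * (N l)%:R ^+ (d - 1) &
        forall x : 'rV[R]_d, (forall i, 0 <= x 0 i <= 1) -> \det (M x + B) = 0 ->
          exists2 c, c \in S & in_box c x.
Proof.
move=> hA.
have N0 l : (0 < N l)%N by rewrite muln_gt0 n0.
have N0' l : 0 < (N l)%:R :> R by rewrite ltr0n.
have mR0 : 0 < m%:R :> R by rewrite ltr0n.
(* The grid is taken so fine that discretization costs at most a quarter of the main term 2 m^2 Lam
   / (N T). This is how 2 becomes the 5 / 2 of the statement. *)
have /choice[D DP] : forall l, exists D : nat, (0 < D)%N /\
    (2 * m%:R ^+ 2 + 1) / D%:R <= m%:R ^+ 2 * Lam / ((N l)%:R * T) / 2 :> R.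
  move=> l; set y := m%:R ^+ 2 * Lam / ((N l)%:R * T) / 2.
  have y0 : 0 < y by rewrite !divr_gt0// !mulr_gt0// exprn_gt0.
  exists (Num.truncn ((2 * m%:R ^+ 2 + 1) / y)).+1; split=> //.
  rewrite ler_pdivrMr ?ltr0Sn// [leRHS]mulrC -ler_pdivrMr//.
  exact/ltW/truncnS_gt.
have D0 l : (0 < D l)%N by case: (DP l).
have D0' l : 0 < (D l)%:R :> R by rewrite ltr0n.
(* The first term covers the variation of [M] in a box, the second the distance from the limit
   matrix to the grid matrix just below it. *)
pose rho l := Lam / (N l)%:R + T / (D l)%:R.
have rho0 l : 0 <= rho l by rewrite addr_ge0// divr_ge0// ltW.
pose bad l p (c : {ffun 'I_d -> 'I_(N l)}) :=
  `[< near_singular (rho l) (M (corner R c) + B (D l) p) >].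
pose X l p : R := (N l)%:R ^- (d - 1) * \sum_c (bad l p c)%:R.
have X0 l p : 0 <= X l p.
  by rewrite mulr_ge0 ?invr_ge0 ?exprn_ge0// sumr_ge0.
have XA l : average (D l) (m * m) (X l) <= 5 / 2 * m%:R ^+ 4 * Lam / T.
  rewrite averageZ average_sum.
  rewrite mulrC ler_pdivrMr ?exprn_gt0//.
  apply: (@le_trans _ _ (\sum_(c : {ffun 'I_d -> 'I_(N l)})
     5 / 2 * m%:R ^+ 4 * Lam / T / (N l)%:R)).
    apply: ler_sum => c _.
    apply: le_trans (average_near_singular _ (D0 l) (rho0 l)) _.
    have [_ hD] := DP l.
    have -> : 5 / 2 * m%:R ^+ 4 * Lam / T / (N l)%:R = m%:R ^+ 2 *
       (2 * m%:R ^+ 2 * Lam / ((N l)%:R * T) + m%:R ^+ 2 * Lam / ((N l)%:R * T) / 2).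
      by field; rewrite !gt_eqF.
    rewrite ler_wpM2l ?exprn_ge0// /rho.
    have -> : 2 * m%:R ^+ 2 * (Lam / (N l)%:R + T / (D l)%:R) / T + (D l)%:R^-1 =
      2 * m%:R ^+ 2 * Lam / ((N l)%:R * T) + (2 * m%:R ^+ 2 + 1) / (D l)%:R.
      by field; rewrite !gt_eqF.
    by rewrite lerD2l.
  rewrite sumr_const card_ffun !card_ord -[leLHS]mulr_natl.
  have -> : (N l ^ d)%:R = (N l)%:R ^+ (d - 1) * (N l)%:R :> R.
    by rewrite natrX -exprSr subn1 prednK.
  rewrite le_eqVlt; apply/orP; left; apply/eqP.
  set P := _ ^+ (d - 1).
  by field; rewrite !gt_eqF.
have [b b01 bP] := reverse_fatou_average D0 X0 XA hA.
exists (\matrix_(i, j) (T * b (index i j) - T / 2)).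
  move=> i j; rewrite mxE; have /andP[b0 b1] := b01 (index i j).
  rewrite ler_norml; apply/andP; split.
    by rewrite lerBrDl subrr mulr_ge0// ltW.
  by rewrite lerBlDr -splitr -[leRHS]mulr1 ler_pM2l// ltW.
move=> l0; have [l l0l [p pb pA]] := bP l0.
exists l => //; exists (finset (bad l p)).
  move: pA; rewrite /X mulrC ler_pdivrMr ?exprn_gt0//; apply: le_trans.
  by rewrite -sum1_card natr_sum big_mkcond/= ler_sum// => c _; rewrite inE; case: (bad _ _ _).
move=> x x01 dx; have [c cx] := in_box_ex (N0 l) x01.
exists c => //; rewrite inE; apply/asboolP.
set Bb := \matrix_(_, _) _ in dx *.
(* Added to the matrix at the corner, this gives back the matrix at [x] with the limit perturbation,
   which is singular. *)
exists (M x - M (corner R c) + (Bb - B (D l) p)).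
  move=> i j; rewrite [X in `|X|]mxE (le_trans (ler_normD _ _))// lerD//.
    by rewrite !mxE; exact: Mlip.
  rewrite !mxE opprB addrA subrK -mulrBr normrM gtr0_norm//.
  rewrite ler_pM2l//.
  have /andP[p1 p2] := pb _ (index_lt i j).
  have /andP[b0 b1] := b01 (index i j).
  rewrite ger0_norm; last by rewrite subr_ge0 ler_pdivrMr// mulrC.
  rewrite lerBlDr -[X in _ <= X + _]mul1r -mulrDl nat1r ler_pdivlMr// mulrC.
  exact: ltW.
by rewrite -dx; congr (\det _); rewrite addrACA !(addrC _ (_ - _)) !subrK.
Qed.

End good_perturbation.

(** * Upper bounds on the Hausdorff measure *)

(** The volume of the circumscribed cube, just enough to cancel the factor (1/2)^s of the gauge. The
    recursion has step two, so two consecutive dimensions are carried along; it suffices that pi <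
    4. *)
Lemma ball_volume_bounds (R : realType) n : 0 <= ball_volume R n <= 2 ^+ n.
Proof.
suff : (0 <= ball_volume R n <= 2 ^+ n) && (0 <= ball_volume R n.+1 <= 2 ^+ n.+1).
  by case/andP.
elim: n => [|n /andP[h1 h2]]; first by rewrite /= expr0 expr1 lexx ler01 ler0n lexx.
rewrite h2 /=; case/andP: h1 => b0 b2.
have c0 : 0 <= 2 * pi / n.+2%:R :> R.
  by rewrite divr_ge0// mulr_ge0// pi_ge0.
rewrite mulr_ge0//= exprS exprS mulrA ler_pM//.
rewrite ler_pdivrMr ?ltr0n//.
have := pihalf_lt2 R; rewrite ltr_pdivrMr// => pi4.
have : 2 <= n.+2%:R :> R by rewrite ler_nat.
by move: (n.+2%:R) => y y2; lra.
Qed.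

Lemma enorm_ge0 (R : realType) n (u : 'rV[R]_n) : 0 <= enorm u.
Proof. exact: sqrtr_ge0. Qed.

Lemma enorm_le_max (R : realType) n (u : 'rV[R]_n) (a : R) : 0 <= a ->
  (forall i, `|u 0 i| <= a) -> enorm u <= Num.sqrt n%:R * a.
Proof.
move=> a0 ua; have -> : Num.sqrt n%:R * a = Num.sqrt (n%:R * a ^+ 2).
  by rewrite sqrtrM// sqrtr_sqr ger0_norm.
apply: ler_wsqrtr.
have -> : n%:R * a ^+ 2 = \sum_(i < n) a ^+ 2.
  by rewrite sumr_const card_ord -[RHS]mulr_natl.
apply: ler_sum => i _.
by rewrite -real_normK ?num_real// lerXn2r// nnegrE.
Qed.

Lemma hausdorff_gauge_le (R : realType) n s (U : set 'rV[R]_n) (e : R) :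
  0 <= e -> (diam U <= e%:E)%E -> (hausdorff_gauge s U <= (e ^+ s)%:E)%E.
Proof.
move=> e0 dU; rewrite /hausdorff_gauge.
case: ifPn => [_|U0]; first by rewrite lee_fin exprn_ge0.
have [x Ux] : U !=set0 by apply/set0P.
have dU0 : (0%:E <= diam U)%E.
  apply: (@le_trans _ _ (enorm (x - x))%:E); first by rewrite lee_fin enorm_ge0.
  by apply: ereal_sup_ubound; exists x, x.
have : diam U \is a fin_num.
  by rewrite ge0_fin_numE//; apply: le_lt_trans dU _; rewrite ltry.
move=> /fineK dE; move: dU0 dU; rewrite -dE !lee_fin => d0 de.
rewrite -EFinM -EFin_expe -EFinM lee_fin exprMn mulrA.
have /andP[b0 b1] := ball_volume_bounds R s.
apply: (@le_trans _ _ (1 * fine (diam U) ^+ s)); last first.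
  by rewrite mul1r lerXn2r// nnegrE.
rewrite ler_wpM2r ?exprn_ge0// exprVn ler_pdivrMr ?mul1r// exprn_gt0.
Qed.

Lemma hausdorff_delta_le (R : realType) n s (A : set 'rV[R]_n) (I : finType)
    (S : {set I}) (V : I -> set 'rV[R]_n) (e delta : R) :
  0 <= e -> e <= delta -> (forall c, (diam (V c) <= e%:E)%E) ->
  (forall x, A x -> exists2 c, c \in S & V c x) ->
  (hausdorff_delta s delta A <= (#|S|%:R * e ^+ s)%:E)%E.
Proof.
move=> e0 ed dV AV.
(* The finite cover is padded with empty sets, whose gauge is 0 even for s = 0. *)
pose U i : set 'rV[R]_n := nth set0 [seq V c | c <- enum S] i.
have Udiam i : (diam (U i) <= e%:E)%E.
  rewrite /U; have [iS|Si] := ltnP i (size [seq V c | c <- enum S]).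
    by have /mapP[c _ ->] := mem_nth (set0 : set 'rV[R]_n) iS.
  rewrite nth_default// /diam.
  by apply: ge_ereal_sup => _ [x [y [[]]]].
apply: (@le_trans _ _ (\sum_(0 <= i <oo) hausdorff_gauge s (U i))%E).
  apply: ereal_inf_lbound; exists U => //; split=> [x Ax|i]; last first.
    by rewrite (le_trans (Udiam i))// lee_fin.
  have [c cS Vcx] := AV x Ax.
  exists (index c (enum S)) => //.
  by rewrite /U (nth_map c) ?index_mem ?mem_enum// nth_index// mem_enum.
have g0 i : (0 <= hausdorff_gauge s (U i))%E.
  rewrite /hausdorff_gauge; case: ifPn => // /set0P[x Ux].
  have /andP[b0 _] := ball_volume_bounds R s.
  rewrite mule_ge0// ?lee_fin// expe_ge0// mule_ge0//.
  apply: (@le_trans _ _ (enorm (x - x))%:E); first by rewrite lee_fin enorm_ge0.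
  by apply: ereal_sup_ubound; exists x, x.
apply: lime_le.
  by apply: is_cvg_nneseries.
apply: nearW => k.
apply: (@le_trans _ _
    (\sum_(0 <= i < k) (if (i < #|S|)%N then e ^+ s else 0)%:E)%E).
  apply: lee_sum => i _; case: ltnP => [_|Si]; first exact: hausdorff_gauge_le.
  by rewrite /hausdorff_gauge /U nth_default ?eqxx// size_map -cardE.
rewrite sumEFin lee_fin.
have -> : \sum_(0 <= i < k) (if (i < #|S|)%N then e ^+ s else 0) =
    (minn k #|S|)%:R * e ^+ s.
  elim: k => [|k IH]; first by rewrite big_nil min0n mul0r.
  rewrite big_nat_recr//= IH; case: ltnP => kS.
    by rewrite !(minn_idPl _) ?(ltnW kS)// -natr1 mulrDl mul1r.
  by rewrite addr0 !(minn_idPr _)// (leq_trans kS).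
by rewrite ler_wpM2r ?exprn_ge0// ler_nat geq_minr.
Qed.

Lemma diam_box_le (R : realType) (d N : nat) (c : {ffun 'I_d -> 'I_N}) :
  (0 < N)%N -> (diam (in_box (R:=R) c) <= (Num.sqrt d%:R / N%:R)%:E)%E.
Proof.
move=> N0; have N0' : 0 < N%:R :> R by rewrite ltr0n.
apply: ge_ereal_sup => _ [x [y [cx cy ->]]]; rewrite lee_fin.
apply: enorm_le_max => [|i]; first by rewrite invr_ge0.
rewrite !mxE -(ler_pM2l N0') divff ?gt_eqF//.
rewrite -[X in X * _](gtr0_norm N0') -normrM mulrBr ler_norml.
have := cx i; have := cy i; rewrite -!natr1.
by move=> /andP[y1 y2] /andP[x1 x2]; apply/andP; split; lra.
Qed.

(** Each scale delta needs only one fine enough cover, so counts along infinitely many [l] suffice.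
    The powers of [N l] in the count and in the diameters cancel. *)
Lemma hausdorff_measure_le (R : realType) (d s : nat) (N : nat -> nat)
    (A : set 'rV[R]_d) (a : R) :
  (forall l, (l < N l)%N) ->
  (forall l0, exists2 l, (l0 <= l)%N &
    exists2 S : {set {ffun 'I_d -> 'I_(N l)}},
      #|S|%:R <= a * (N l)%:R ^+ s &
      forall x, A x -> exists2 c, c \in S & in_box c x) ->
  (hausdorff_measure s A <= (Num.sqrt d%:R ^+ s * a)%:E)%E.
Proof.
move=> Nl cov; apply: ge_ereal_sup => _ [delta /= delta0 <-].
pose l0 := Num.truncn (Num.sqrt d%:R / delta).
have [l l0l [S Sa AS]] := cov l0.
have N0 : 0 < (N l)%:R :> R by rewrite ltr0n (leq_ltn_trans _ (Nl l)).
have e0 : 0 <= Num.sqrt d%:R / (N l)%:R :> R by rewrite divr_ge0// sqrtr_ge0.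
apply: le_trans (hausdorff_delta_le s e0 _ _ AS) _.
- rewrite ler_pdivrMr// mulrC -ler_pdivrMr//.
  apply/ltW; apply: lt_le_trans (truncnS_gt _) _.
  by rewrite ler_nat (leq_trans _ (Nl l)).
- by move=> c; apply: diam_box_le; rewrite (leq_ltn_trans _ (Nl l)).
- rewrite lee_fin exprMn mulrCA ler_wpM2l ?exprn_ge0 ?sqrtr_ge0//.
  by rewrite exprVn ler_pdivrMr// exprn_gt0.
Qed.

(** * A smooth step and the partition of unity *)

Lemma is_derive_quadratic (R : realType) (f : R -> R) (x l C : R) :
  (forall k, `|f (x + k) - f x - l * k| <= C * k ^+ 2) -> is_derive x 1 f l.
Proof.
move=> fq; have C0 : 0 <= C.
  have := fq 1; by rewrite expr1n [C * 1]mulr1; apply: le_trans.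
have cv : k^-1 *: (f (k *: 1 + x) - f x) @[k --> 0^'] --> l.
  apply/cvgrPdist_le => /= e e0.
  (* The summand 1 keeps the denominator positive when C = 0. *)
  exists (e / (C + 1)) => /=; first by rewrite divr_gt0// ltr_wpDl.
  move=> k /=; rewrite sub0r normrN => ke k0.
  set D := f _ - f x; rewrite -[k^-1 *: D]/(k^-1 * D).
  have -> : l - k^-1 * D = k^-1 * (k * l - D) by rewrite [in RHS]mulrBr mulKf.
  rewrite normrM normfV ler_pdivrMl ?normr_gt0//.
  rewrite distrC /D -[k *: 1]/(k * 1) mulr1 [k + x]addrC [k * l]mulrC.
  apply: le_trans (fq k) _; rewrite -real_normK ?num_real// expr2 mulrA mulrC.
  rewrite ler_wpM2l//; move: ke; rewrite ltr_pdivlMr; last by rewrite ltr_wpDl.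
  by move=> /ltW; apply: le_trans; rewrite mulrC ler_wpM2l// lerDl.
by split; [apply/cvg_ex; exists l|exact/cvg_lim].
Qed.

Section smooth_step.
Variable R : realType.
Implicit Types s t : R.

Definition ramp s : R := Num.max s 0.

(** The quadratic spline from 0 to 1 with knots 0, 1/2, 1 and second derivative 4, then -4. Squared
    ramps give its derivative by one formula, valid at the knots too. *)
Definition sstep s : R :=
  2 * ramp s ^+ 2 - 4 * ramp (s - 2^-1) ^+ 2 + 2 * ramp (s - 1) ^+ 2.

Definition dsstep s : R := 4 * ramp s - 8 * ramp (s - 2^-1) + 4 * ramp (s - 1).

Lemma ramp_ge0 s : 0 <= s -> ramp s = s.
Proof. by move=> s0; apply/max_idPl. Qed.

Lemma ramp_le0 s : s <= 0 -> ramp s = 0.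
Proof. by move=> s0; apply/max_idPr. Qed.

Lemma sstep_le0 s : s <= 0 -> sstep s = 0.
Proof. by move=> s0; rewrite /sstep !ramp_le0; lra. Qed.

Lemma dsstep_le0 s : s <= 0 -> dsstep s = 0.
Proof. by move=> s0; rewrite /dsstep !ramp_le0; lra. Qed.

Lemma sstep_ge1 s : 1 <= s -> sstep s = 1.
Proof. by move=> s1; rewrite /sstep !ramp_ge0; [field|lra..]. Qed.

Lemma dsstep_ge1 s : 1 <= s -> dsstep s = 0.
Proof. by move=> s1; rewrite /dsstep !ramp_ge0; [field|lra..]. Qed.

Lemma sstep_left s : 0 <= s <= 2^-1 -> sstep s = 2 * s ^+ 2 /\ dsstep s = 4 * s.
Proof.
move=> /andP[s0 s2]; rewrite /sstep /dsstep.
by rewrite (ramp_ge0 s0) !ramp_le0; [split; ring|lra..].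
Qed.

Lemma sstep_right s : 2^-1 <= s <= 1 ->
  sstep s = 1 - 2 * (1 - s) ^+ 2 /\ dsstep s = 4 * (1 - s).
Proof.
move=> /andP[s0 s2]; rewrite /sstep /dsstep.
rewrite (@ramp_ge0 s) ?(@ramp_ge0 (s - 2^-1)) ?(@ramp_le0 (s - 1)); [|lra..].
by split; field.
Qed.

Lemma sstep_itv s : 0 <= s <= 1 -> 0 <= sstep s <= 1 /\ 0 <= dsstep s <= 2.
Proof.
move=> /andP[s0 s1]; have [s2|/ltW s2] := leP s 2^-1.
  have [|-> ->] := @sstep_left s; first by apply/andP.
  by split; nra.
have [|-> ->] := @sstep_right s; first by apply/andP.
by split; nra.
Qed.

Lemma sstep_lip s t : 0 <= s <= 1 -> 0 <= t <= 1 ->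
  `|sstep s - sstep t| <= 2 * `|s - t| /\ `|dsstep s - dsstep t| <= 4 * `|s - t|.
Proof.
wlog st : s t / s <= t.
  move=> h s01 t01; have [st|/ltW ts] := leP s t; first exact: h.
  have := h _ _ ts t01 s01.
  by rewrite (distrC (sstep t)) (distrC (dsstep t)) (distrC t).
move=> /andP[s0 s1] /andP[t0 t1].
have ts0 : 0 <= t - s by rewrite subr_ge0.
rewrite !(distrC s t) (ger0_norm ts0) !ler_norml.
have p1 := mulr_ge0 ts0 s0; have p2 := mulr_ge0 ts0 t0.
have p3 : 0 <= (t - s) * (1 - s) by rewrite mulr_ge0// subr_ge0.
have p4 : 0 <= (t - s) * (1 - t) by rewrite mulr_ge0// subr_ge0.
have p5 := sqr_ge0 (s - 2^-1); have p6 := sqr_ge0 (t - 2^-1).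
have [s2|/ltW s2] := leP s 2^-1; have [t2|/ltW t2] := leP t 2^-1.
- have [|-> ->] := @sstep_left s; first by apply/andP.
  have [|-> ->] := @sstep_left t; first by apply/andP.
  have q : 0 <= (t - s) * (2^-1 - t + (2^-1 - s)).
    by apply: mulr_ge0 => //; lra.
  by split; apply/andP; split; nra.
- have [|-> ->] := @sstep_left s; first by apply/andP.
  have [|-> ->] := @sstep_right t; first by apply/andP.
  have q1 : 0 <= s * (2^-1 - s) by rewrite mulr_ge0// subr_ge0.
  have q2 : 0 <= (1 - t) * (t - 2^-1) by rewrite mulr_ge0// subr_ge0.
  by split; apply/andP; split; nra.
- have -> : s = t by lra.
  by rewrite !subrr; split; lra.
- have [|-> ->] := @sstep_right s; first by apply/andP.
  have q : 0 <= (t - s) * (t - 2^-1 + (s - 2^-1)).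
    by apply: mulr_ge0 => //; lra.
  have [|-> ->] := @sstep_right t; first by apply/andP.
  by split; apply/andP; split; nra.
Qed.

Lemma ramp_sqr_quadratic s k :
  `|ramp (s + k) ^+ 2 - ramp s ^+ 2 - 2 * ramp s * k| <= k ^+ 2.
Proof.
rewrite ler_norml; have [s0|/ltW s0] := leP 0 s; have [k0|/ltW k0] := leP 0 (s + k).
- by rewrite !ramp_ge0//; nra.
- by rewrite (ramp_ge0 s0) (ramp_le0 k0); nra.
- by rewrite (ramp_le0 s0) (ramp_ge0 k0); nra.
- by rewrite !ramp_le0//; nra.
Qed.

Lemma is_derive_sstep s : is_derive s 1 sstep (dsstep s).
Proof.
(* 8 = 2 + 4 + 2, the sizes of the coefficients of the three squared ramps. *)
apply: (@is_derive_quadratic _ _ _ _ 8) => k.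
have := ramp_sqr_quadratic s k; have := ramp_sqr_quadratic (s - 2^-1) k.
have := ramp_sqr_quadratic (s - 1) k.
rewrite /sstep /dsstep ![s - _ + k]addrAC !ler_norml.
move=> /andP[? ?] /andP[? ?] /andP[? ?]; apply/andP; split; lra.
Qed.

Lemma continuous_ramp : continuous ramp.
Proof. by move=> s; apply: continuous_max => //; exact: cvg_cst. Qed.

Lemma continuous_dsstep : continuous dsstep.
Proof.
move=> s; apply: cvgD; [apply: cvgB|]; apply: cvgM; try exact: cvg_cst.
- exact: continuous_ramp.
- apply: (@continuous_comp _ _ _ (fun s => s - 2^-1) ramp); last exact: continuous_ramp.
  by apply: cvgB => //; exact: cvg_cst.
- apply: (@continuous_comp _ _ _ (fun s => s - 1) ramp); last exact: continuous_ramp.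
  by apply: cvgB => //; exact: cvg_cst.
Qed.

End smooth_step.

(** * Products of one-dimensional weights *)

Section tensor_weights.
Variables (R : realType) (d n : nat).
Implicit Types (w : 'I_d -> 'I_n.+1 -> R) (v : {ffun 'I_d -> 'I_n.+1}).

Definition tensor w (v : {ffun 'I_d -> 'I_n.+1}) : R := \prod_i w i (v i).

Lemma sum_tensor w : \sum_v tensor w v = \prod_i \sum_a w i a.
Proof. by rewrite bigA_distr_bigA. Qed.

(** The bound on [r] is asked only where the weight does not vanish: a Taylor polynomial is close to
    the function only if its node is near the point. *)
Lemma tensor_combination_le w (r : {ffun 'I_d -> 'I_n.+1} -> R) (b : R) :
  0 <= b -> (forall v, (forall i, w i (v i) != 0) -> `|r v| <= b) ->
  `|\sum_v tensor w v * r v| <= (\prod_i \sum_a `|w i a|) * b.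
Proof.
move=> b0 rb; rewrite bigA_distr_bigA/= mulr_suml.
apply: le_trans (ler_norm_sum _ _ _) _; apply: ler_sum => v _.
rewrite normrM normr_prod; have [w0|] := boolP [forall i, w i (v i) != 0].
  by rewrite ler_wpM2l ?prodr_ge0//; apply: rb; exact/forallP.
rewrite negb_forall => /existsP[i]; rewrite negbK => /eqP wi.
by rewrite (bigD1 i)//= wi normr0 !mul0r.
Qed.

(* Only the coordinate [j] of the weights varies. *)
Lemma tensorB w w' w'' (j : 'I_d) v :
  (forall i, i != j -> w' i (v i) = w i (v i) /\ w'' i (v i) = w i (v i)) ->
  w j (v j) = w' j (v j) - w'' j (v j) -> tensor w v = tensor w' v - tensor w'' v.
Proof.
move=> e ej; rewrite /tensor !(bigD1 j (P := xpredT))//= ej.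
have -> : \prod_(i < d | i != j) w' i (v i) = \prod_(i < d | i != j) w i (v i).
  by apply: eq_bigr => i /e[].
have -> : \prod_(i < d | i != j) w'' i (v i) = \prod_(i < d | i != j) w i (v i).
  by apply: eq_bigr => i /e[].
by rewrite mulrBl.
Qed.

Definition two_point (a : nat) (u u' : R) (b : 'I_n.+1) : R :=
  (b == a :> nat)%:R * u + (b == a.+1 :> nat)%:R * u'.

(** [G] is there to cover plain sums and sums of absolute values at once. *)
Lemma sum_two_point (a : nat) (G : 'I_n.+1 -> R -> R) u u' (an : (a < n)%N) :
  (forall b, G b 0 = 0) ->
  \sum_b G b (two_point a u u' b) =
  G (Ordinal (ltnW an : (a < n.+1)%N)) u + G (Ordinal (an : (a.+1 < n.+1)%N)) u'.
Proof.
move=> G0; set i := Ordinal _; set i' := Ordinal _.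
have ii' : i' != i by apply/eqP => /(congr1 val)/= /eqP; rewrite gtn_eqF.
rewrite (bigD1 i)//= (bigD1 i')//= big1 ?addr0 => [|b /andP[bi bi']].
  rewrite /two_point/= eqxx eqn_leq ltnn andbF mul1r mul0r addr0.
  by rewrite eqn_leq ltnn/= mul0r add0r eqxx mul1r.
rewrite /two_point.
by rewrite (negbTE (bi : (b != a :> nat))) (negbTE (bi' : (b != a.+1 :> nat))) !mul0r addr0 G0.
Qed.

Lemma two_point_neq0 (a : nat) u u' b : two_point a u u' b != 0 ->
  (b == a :> nat) || (b == a.+1 :> nat).
Proof.
rewrite /two_point; case: (_ == a); case: (_ == a.+1) => //.
by rewrite !mul0r addr0 eqxx.
Qed.

End tensor_weights.

Section partition_of_unity.
Variables (R : realType) (kappa : R).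

(** For kappa > 0, a bump around k / kappa that vanishes outside the two adjacent cells. For kappa =
    0 it is constant, 1 for k = 0 and 0 otherwise. *)
Definition pou (k : nat) (s : R) : R :=
  sstep (kappa * s - k%:R + 1) - sstep (kappa * s - k%:R).

Definition dpou (k : nat) (s : R) : R :=
  kappa * (dsstep (kappa * s - k%:R + 1) - dsstep (kappa * s - k%:R)).

Lemma is_derive_pou k (s : R) : is_derive s 1 (pou k) (dpou k s).
Proof.
have d1 (c : R) : is_derive s 1 (fun s : R => sstep (kappa * s + c))
    (kappa * dsstep (kappa * s + c)).
  have := @is_derive1_comp _ (@sstep R) (fun s => kappa * s + c) s _ kappa
    (is_derive_sstep _).
  by rewrite mulrC; apply; apply: is_derive_eq; rewrite addr0; exact: mulr1.
have -> : dpou k s = kappa * dsstep (kappa * s + (- k%:R + 1)) -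
    kappa * dsstep (kappa * s + - k%:R) by rewrite /dpou mulrBr addrA.
have -> : pou k = (fun s => sstep (kappa * s + (- k%:R + 1))) -
   (fun s => sstep (kappa * s + - k%:R)).
  by apply/funext => t; rewrite /pou !fctE addrA.
exact: is_deriveB.
Qed.

Lemma continuous_pou k : continuous (pou k).
Proof.
move=> s; apply: differentiable_continuous; apply/derivable1_diffP.
by have := is_derive_pou k s; case.
Qed.

Lemma continuous_dpou k : continuous (dpou k).
Proof.
have h (c : R) : continuous (fun s => dsstep (kappa * s + c)).
  move=> s; apply: (@continuous_comp _ _ _ (fun s => kappa * s + c)).
    by apply: cvgD; [apply: cvgM => //; exact: cvg_cst|exact: cvg_cst].
  exact: continuous_dsstep.
have -> : dpou k = (fun s => kappa * (dsstep (kappa * s + (- k%:R + 1)) -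
    dsstep (kappa * s + - k%:R))).
  by apply/funext => s; rewrite /dpou addrA.
by move=> s; apply: cvgM; [exact: cvg_cst|apply: cvgB; exact: h].
Qed.

Variables (n a : nat).

Lemma pou_cell s (b : 'I_n.+1) : 0 <= kappa * s - a%:R <= 1 ->
  pou b s = two_point a (1 - sstep (kappa * s - a%:R)) (sstep (kappa * s - a%:R)) b /\
  dpou b s = two_point a (- kappa * dsstep (kappa * s - a%:R))
               (kappa * dsstep (kappa * s - a%:R)) b.
Proof.
set t := kappa * s; move=> /andP[t0 t1].
rewrite /pou /dpou -/t /two_point.
have [ba|ab|ba] := ltngtP b a.
- have hb : (b%:R + 1 <= a%:R :> R) by rewrite natr1 ler_nat.
  rewrite (_ : (b == a.+1 :> nat) = false); last by apply/eqP; lia.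
  rewrite !(@sstep_ge1 _ (t - b%:R)) ?(@sstep_ge1 _ (t - b%:R + 1)); [|lra..].
  rewrite !(@dsstep_ge1 _ (t - b%:R)) ?(@dsstep_ge1 _ (t - b%:R + 1)); [|lra..].
  by rewrite /= !mul0r !subrr mulr0 addr0.
- have [ba1|ba1] := eqVneq (b : nat) a.+1.
    rewrite ba1 -natr1 (@sstep_le0 _ (t - (_ + _))) ?(@dsstep_le0 _ (t - (_ + _))); [|lra..].
    rewrite (_ : t - (a%:R + 1) + 1 = t - a%:R); last by ring.
    by rewrite /= !mul0r !mul1r !add0r !subr0.
  have hb : (a%:R + 2 <= b%:R :> R) by rewrite -natrD ler_nat; lia.
  rewrite !(@sstep_le0 _ (t - b%:R)) ?(@sstep_le0 _ (t - b%:R + 1)); [|lra..].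
  rewrite !(@dsstep_le0 _ (t - b%:R)) ?(@dsstep_le0 _ (t - b%:R + 1)); [|lra..].
  by rewrite /= !mul0r !subrr mulr0 addr0.
- rewrite (_ : (b == a.+1 :> nat) = false); last by apply/eqP; lia.
  rewrite ba (@sstep_ge1 _ (t - _ + 1)) ?(@dsstep_ge1 _ (t - _ + 1)); [|lra..].
  by rewrite /= !mul0r !mul1r !addr0 sub0r mulrN mulNr.
Qed.

End partition_of_unity.

Section pou_sums.
Variables (R : realType) (kappa : R) (n a : nat).
Hypotheses (kappa0 : 0 <= kappa) (an : (a < n)%N).
Implicit Types s t : R.
Let cell s := 0 <= kappa * s - a%:R <= 1.

Lemma pou_near s (b : 'I_n.+1) : cell s ->
  pou kappa b s != 0 \/ dpou kappa b s != 0 -> (b == a :> nat) || (b == a.+1 :> nat).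
Proof.
by move=> /(@pou_cell _ _ n _ _ b) [-> ->] []; exact: two_point_neq0.
Qed.

Lemma sum_pou s : cell s -> \sum_(b < n.+1) pou kappa b s = 1.
Proof.
move=> cs; under eq_bigr => b do rewrite (pou_cell b cs).1.
by rewrite (sum_two_point (G := fun _ x => x) _ _ an)// subrK.
Qed.

Lemma sum_dpou s : cell s -> \sum_(b < n.+1) dpou kappa b s = 0.
Proof.
move=> cs; under eq_bigr => b do rewrite (pou_cell b cs).2.
by rewrite (sum_two_point (G := fun _ x => x) _ _ an)// mulNr addNr.
Qed.

Lemma sum_norm_pou s : cell s -> \sum_(b < n.+1) `|pou kappa b s| = 1.
Proof.
move=> cs; under eq_bigr => b do rewrite (pou_cell b cs).1.
rewrite (sum_two_point (G := fun _ x => `|x|) _ _ an) ?normr0//.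
have [/andP[s0 s1] _] := sstep_itv cs.
by rewrite !ger0_norm ?subr_ge0// subrK.
Qed.

Lemma sum_norm_dpou s : cell s -> \sum_(b < n.+1) `|dpou kappa b s| <= 4 * kappa.
Proof.
move=> cs; under eq_bigr => b do rewrite (pou_cell b cs).2.
rewrite (sum_two_point (G := fun _ x => `|x|) _ _ an) ?normr0//.
have [_ /andP[s0 s1]] := sstep_itv cs.
have := ler_wpM2l kappa0 s1.
by rewrite mulNr normrN ger0_norm ?mulr_ge0//; lra.
Qed.

Let two_pointB u1 u1' u2 u2' (b : 'I_n.+1) :
  two_point a u1 u1' b - two_point a u2 u2' b = two_point a (u1 - u2) (u1' - u2') b :> R.
Proof. by rewrite /two_point; ring. Qed.

Lemma sum_norm_pouB s t : cell s -> cell t ->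
  \sum_(b < n.+1) `|pou kappa b s - pou kappa b t| <= 4 * kappa * `|s - t|.
Proof.
move=> cs ct; under eq_bigr => b do rewrite (pou_cell b cs).1 (pou_cell b ct).1 two_pointB.
rewrite (sum_two_point (G := fun _ x => `|x|) _ _ an) ?normr0//.
have [+ _] := sstep_lip cs ct; rewrite (_ : _ - _ - (_ - _) = kappa * (s - t)); last by ring.
rewrite (_ : _ - _ - (1 - _) = - (sstep (kappa * s - a%:R) - sstep (kappa * t - a%:R)));
  last by ring.
by rewrite normrM normrN (ger0_norm kappa0); lra.
Qed.

Lemma sum_norm_dpouB s t : cell s -> cell t ->
  \sum_(b < n.+1) `|dpou kappa b s - dpou kappa b t| <= 8 * kappa ^+ 2 * `|s - t|.
Proof.
move=> cs ct; under eq_bigr => b do rewrite (pou_cell b cs).2 (pou_cell b ct).2 two_pointB.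
rewrite (sum_two_point (G := fun _ x => `|x|) _ _ an) ?normr0//.
have [_] := sstep_lip cs ct; rewrite (_ : _ - _ - (_ - _) = kappa * (s - t)); last by ring.
rewrite mulNr mulNr -opprD normrN -mulrBr !normrM (ger0_norm kappa0) => /(ler_wpM2l kappa0).
by lra.
Qed.

End pou_sums.

(** * Smoothing by blending Taylor polynomials *)

(** In the main use [i] is the coordinate of differentiation and [j] the one that moves; only these
    factors can exceed 1, and if they coincide one factor has to carry both bounds. *)
Lemma prod_le2 (R : realFieldType) (d : nat) (z : 'I_d -> R) (i j : 'I_d) (A B : R) :
  (forall k, 0 <= z k) -> (forall k, k != i -> k != j -> z k <= 1) ->
  0 <= A -> (i != j -> z i <= A) -> (i != j -> z j <= B) -> (i = j -> z j <= A * B) ->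
  \prod_k z k <= A * B.
Proof.
move=> z0 z1 A0 zi zj zij.
have le1 (Q : pred 'I_d) : (forall k, Q k -> z k <= 1) -> \prod_(k | Q k) z k <= 1.
  by move=> h; apply: prodr_ile1 => k Qk; rewrite z0 h.
rewrite (bigD1 j)//=; have [ij|ij] := eqVneq i j.
  apply: (@le_trans _ _ (z j * 1)); last by rewrite mulr1; exact: zij.
  by rewrite ler_wpM2l// le1// => k kj; rewrite z1// ij.
rewrite (bigD1 i)//= mulrCA ler_pM ?z0 ?zi//.
  by rewrite mulr_ge0// prodr_ge0.
apply: (@le_trans _ _ (z j * 1)); last by rewrite mulr1; exact: zj.
by rewrite ler_wpM2l// le1// => k /andP[kj ki]; rewrite z1.
Qed.

Section smoothing.
Variables (R : realType) (d n : nat) (kappa om : R).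
Variables (F : 'rV[R]_d -> R) (P : 'rV[R]_d -> 'I_d -> R).
(** Meant for two cases: kappa = n, a genuine blending, and n = 1 with kappa = 0, where all weight
    stays on the Taylor polynomial at the origin. *)
Hypotheses (n0 : (0 < n)%N) (kappa0 : 0 <= kappa) (kappan : kappa <= n%:R).
Hypothesis kappa_cell : forall (a : 'I_n) s, a%:R <= n%:R * s <= a.+1%:R ->
  0 <= kappa * s - a%:R <= 1.
Hypothesis om0 : 0 <= om.
Hypothesis taylor : forall x v, cube d x -> cube d v ->
  (forall i, `|x 0 i - v 0 i| <= n%:R^-1) ->
  `|F x - F v - \sum_i P v i * (x 0 i - v 0 i)| <= \sum_i om * `|x 0 i - v 0 i|.
Hypothesis osc : forall x v, cube d x -> cube d v ->
  (forall i, `|x 0 i - v 0 i| <= n%:R^-1) -> forall i, `|P v i - P x i| <= om.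

Implicit Types (x y : 'rV[R]_d) (v : {ffun 'I_d -> 'I_n.+1}) (c : {ffun 'I_d -> 'I_n}).

Definition node v : 'rV[R]_d := \row_i ((v i)%:R / n%:R).

Definition taylor_at v x : R := F (node v) + \sum_i P (node v) i * (x 0 i - node v 0 i).

Definition pouw x i (b : 'I_n.+1) : R := pou kappa b (x 0 i).

Definition dpouw j x i (b : 'I_n.+1) : R :=
  if i == j then dpou kappa b (x 0 i) else pou kappa b (x 0 i).

Definition smooth x : R := \sum_v tensor (pouw x) v * taylor_at v x.

(** The product rule for the partial derivative; it is estimated as a formula here and identified
    with the derivative in [is_derive_smooth]. *)
Definition dsmooth x j : R :=
  \sum_v (tensor (dpouw j x) v * taylor_at v x + tensor (pouw x) v * P (node v) j).

Let near c v := forall i, (v i == c i :> nat) || (v i == (c i).+1 :> nat).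

Let nR0 : 0 < n%:R :> R. Proof. by rewrite ltr0n. Qed.

Let near_node c v x : in_box c x -> near c v ->
  cube d (node v) /\ (forall i, `|x 0 i - node v 0 i| <= n%:R^-1).
Proof.
move=> cx cv; split => i; rewrite !mxE.
  rewrite divr_ge0//= ler_pdivrMr// mul1r ler_nat.
  by rewrite -ltnS.
rewrite -(ler_pM2l nR0) divff ?gt_eqF//.
rewrite -{1}(gtr0_norm nR0) -normrM mulrBr [n%:R * (_ / _)]mulrC divfK ?gt_eqF//.
have := cx i; rewrite -natr1 ler_norml; case/orP: (cv i) => /eqP ->.
  by move=> /andP[? ?]; apply/andP; split; lra.
by rewrite -natr1 => /andP[? ?]; apply/andP; split; lra.
Qed.

Let taylor_at_le c v x : cube d x -> in_box c x -> near c v ->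
  `|taylor_at v x - F x| <= d%:R * om / n%:R.
Proof.
move=> x01 cx cv; have [v01 xv] := near_node cx cv.
rewrite distrC /taylor_at opprD addrA; apply: le_trans (taylor x01 v01 xv) _.
apply: (@le_trans _ _ (\sum_(i < d) om / n%:R)).
  by apply: ler_sum => i _; rewrite ler_wpM2l.
by rewrite sumr_const card_ord -[leLHS]mulr_natl mulrA.
Qed.

Let cell_of c x i : in_box c x -> 0 <= kappa * x 0 i - (c i)%:R <= 1.
Proof. by move=> cx; exact: kappa_cell. Qed.

Let near_pouw c x v : in_box c x -> (forall i, pouw x i (v i) != 0) -> near c v.
Proof. by move=> cx h i; apply: (pou_near (cell_of i cx)); left; exact: h. Qed.

Let near_dpouw c x j v : in_box c x -> (forall i, dpouw j x i (v i) != 0) -> near c v.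
Proof.
move=> cx h i; apply: (pou_near (cell_of i cx)).
by move: (h i); rewrite /dpouw; case: ifP; [right|left].
Qed.

Let sum_tensor_pouw c x : in_box c x -> \sum_v tensor (pouw x) v = 1.
Proof.
move=> cx; rewrite sum_tensor big1// => i _.
exact: (sum_pou (ltn_ord (c i)) (cell_of i cx)).
Qed.

Let sum_tensor_dpouw c x j : in_box c x -> \sum_v tensor (dpouw j x) v = 0.
Proof.
move=> cx; rewrite sum_tensor (bigD1 j)//=.
under eq_bigr do rewrite /dpouw eqxx.
by rewrite (sum_dpou (ltn_ord (c j)) (cell_of j cx)) mul0r.
Qed.

Let prod_pouw_le c x : in_box c x -> \prod_i \sum_b `|pouw x i b| <= 1.
Proof.
move=> cx; apply: prodr_ile1 => i _.
rewrite (sum_norm_pou (ltn_ord (c i)) (cell_of i cx)).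
by rewrite ler01 lexx.
Qed.

Let prod_dpouw_le c x j : in_box c x -> \prod_i \sum_b `|dpouw j x i b| <= 4 * kappa.
Proof.
move=> cx; rewrite -[leRHS]mulr1; apply: (@prod_le2 _ _ _ j j).
- by move=> k; apply: sumr_ge0.
- move=> k /negbTE kj _; under eq_bigr do rewrite /dpouw kj.
  by rewrite (sum_norm_pou (ltn_ord (c k)) (cell_of k cx)).
- by rewrite mulr_ge0.
- by rewrite eqxx.
- by rewrite eqxx.
- move=> _; under eq_bigr do rewrite /dpouw eqxx.
  by rewrite mulr1 (sum_norm_dpou kappa0 (ltn_ord (c j)) (cell_of j cx)).
Qed.

Let smoothB c x (r : R) : in_box c x ->
  smooth x - r = \sum_v tensor (pouw x) v * (taylor_at v x - r).
Proof.
move=> cx; rewrite /smooth -[r in LHS]mul1r -(sum_tensor_pouw cx) mulr_suml -sumrB.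
by apply: eq_bigr => v _; rewrite mulrBr.
Qed.

Lemma smooth_approx x : cube d x -> `|smooth x - F x| <= d%:R * om / n%:R.
Proof.
move=> x01; have [c cx] := in_box_ex n0 x01.
rewrite (smoothB _ cx) -[leRHS]mul1r.
have b0 : 0 <= d%:R * om / n%:R by rewrite divr_ge0// mulr_ge0.
apply: le_trans (tensor_combination_le b0 _) _.
  by move=> v /(near_pouw cx); exact: taylor_at_le.
by rewrite ler_wpM2r// (prod_pouw_le cx).
Qed.

(** The differentiated weights sum to 0 and the weights to 1, so [F x] and [P x j] can be subtracted
    under the sums. The steepness 4 kappa then meets a Taylor error d om / n, and kappa <= n leaves
    4 d om. *)
Lemma dsmooth_approx x j : cube d x ->
  `|dsmooth x j - P x j| <= (4 * d%:R + 1) * om.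
Proof.
move=> x01; have [c cx] := in_box_ex n0 x01.
have -> : dsmooth x j - P x j =
    \sum_v tensor (dpouw j x) v * (taylor_at v x - F x) +
    \sum_v tensor (pouw x) v * (P (node v) j - P x j).
  rewrite /dsmooth big_split/=.
  under [in RHS]eq_bigr do rewrite mulrBr; rewrite sumrB -mulr_suml.
  under [X in _ = _ + X]eq_bigr do rewrite mulrBr.
  rewrite sumrB -[X in _ = _ + (_ - X)]mulr_suml.
  by rewrite (sum_tensor_dpouw _ cx) (sum_tensor_pouw cx) mul0r mul1r subr0 addrA.
rewrite (le_trans (ler_normD _ _))// mulrDl mul1r lerD//.
  have b0 : 0 <= d%:R * om / n%:R by rewrite divr_ge0// mulr_ge0.
  apply: le_trans (tensor_combination_le b0 _) _.
    by move=> v /(near_dpouw cx); exact: taylor_at_le.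
  apply: le_trans (ler_wpM2r b0 (prod_dpouw_le j cx)) _.
  rewrite [leLHS](_ : _ = 4 * d%:R * om * (kappa / n%:R)); last by ring.
  by rewrite -[leRHS]mulr1 ler_wpM2l ?mulr_ge0// ler_pdivrMr// mul1r.
apply: le_trans (tensor_combination_le om0 _) _.
  move=> v /(near_pouw cx) cv; have [v01 xv] := near_node cx cv.
  exact: osc.
by rewrite -[leRHS]mul1r ler_wpM2r// (prod_pouw_le cx).
Qed.

Let near_diff (f : 'rV[R]_d -> forall i : 'I_d, 'I_n.+1 -> R) c x y j v :
  (forall k z, in_box c z -> f z k (v k) != 0 ->
    (v k == c k :> nat) || (v k == (c k).+1 :> nat)) ->
  in_box c x -> in_box c y ->
  (forall k, (if k == j then f x k (v k) - f y k (v k) else f x k (v k)) != 0) ->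
  near c v.
Proof.
move=> fn cx cy h k; move: (h k); case: ifP => [_|_]; last exact: fn.
have [f0|f0 _] := eqVneq (f x k (v k)) 0; last exact: fn f0.
by rewrite f0 sub0r oppr_eq0; exact: fn.
Qed.

Let dsmooth_step c x y i j h : cube d x -> in_box c x -> in_box c y ->
  (forall k, k != j -> x 0 k = y 0 k) -> `|x 0 j - y 0 j| <= h ->
  `|dsmooth x i - dsmooth y i| <= (16 * d%:R + 8) * (kappa * om * h).
Proof.
move=> x01 cx cy exy hxy; have h0 : 0 <= h := le_trans (normr_ge0 _) hxy.
pose wD k (b : 'I_n.+1) :=
  if k == j then dpouw i x k b - dpouw i y k b else dpouw i x k b.
pose wP k (b : 'I_n.+1) :=
  if k == j then pouw x k b - pouw y k b else pouw x k b.
have wDE v : tensor wD v = tensor (dpouw i x) v - tensor (dpouw i y) v.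
  apply: (@tensorB _ _ _ _ _ _ j); last by rewrite /wD eqxx.
  by move=> k kj; rewrite /wD (negbTE kj)/dpouw exy.
have wPE v : tensor wP v = tensor (pouw x) v - tensor (pouw y) v.
  apply: (@tensorB _ _ _ _ _ _ j); last by rewrite /wP eqxx.
  by move=> k kj; rewrite /wP (negbTE kj)/pouw exy.
have tE v : taylor_at v x - taylor_at v y = P (node v) j * (x 0 j - y 0 j).
  rewrite /taylor_at opprD addrACA subrr add0r -sumrB (bigD1 j)//= big1 ?addr0.
    by ring.
  by move=> k kj; rewrite exy// subrr.
(* Three sources of change: the differentiated weights, the Taylor polynomials and the weights. The
   weights of each sum add up to 0, which allows values at [x] to be subtracted; the sums contribute
   16 d, 4 and 4 to the constant. *)
have -> : dsmooth x i - dsmooth y i =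
    \sum_v tensor wD v * (taylor_at v x - F x) +
    \sum_v tensor (dpouw i y) v * ((P (node v) j - P x j) * (x 0 j - y 0 j)) +
    \sum_v tensor wP v * (P (node v) i - P x i).
  have sD : \sum_v tensor wD v * F x = 0.
    by rewrite -mulr_suml; under eq_bigr do rewrite wDE;
      rewrite sumrB !(sum_tensor_dpouw _ cx) (sum_tensor_dpouw _ cy) subrr mul0r.
  have sP : \sum_v tensor wP v * P x i = 0.
    by rewrite -mulr_suml; under eq_bigr do rewrite wPE;
      rewrite sumrB (sum_tensor_pouw cx) (sum_tensor_pouw cy) subrr mul0r.
  have sD' : \sum_v tensor (dpouw i y) v * (P x j * (x 0 j - y 0 j)) = 0.
    by rewrite -mulr_suml (sum_tensor_dpouw _ cy) mul0r.
  under [X in _ = X + _ + _]eq_bigr do rewrite mulrBr.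
  under [X in _ = _ + X + _]eq_bigr do rewrite mulrBl mulrBr.
  under [X in _ = _ + _ + X]eq_bigr do rewrite mulrBr.
  rewrite !sumrB sD sP sD' !subr0 /dsmooth -sumrB -!big_split/=.
  by apply: eq_bigr => v _; rewrite -tE wDE wPE; ring.
have knear k z v : in_box c z -> dpouw i z k (v k) != 0 ->
    (v k == c k :> nat) || (v k == (c k).+1 :> nat).
  move=> cz; rewrite /dpouw => hk; apply: (pou_near (cell_of k cz)).
  by move: hk; case: ifP; [right|left].
have knear' k z v : in_box c z -> pouw z k (v k) != 0 ->
    (v k == c k :> nat) || (v k == (c k).+1 :> nat).
  by move=> cz hk; apply: (pou_near (cell_of k cz)); left.
have b0 : 0 <= d%:R * om / n%:R by rewrite divr_ge0// mulr_ge0.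
have -> : (16 * d%:R + 8) * (kappa * om * h) =
  16 * d%:R * (kappa * om * h) + 4 * kappa * (om * h) + 4 * kappa * h * om by ring.
rewrite (le_trans (ler_normD _ _))// lerD//; first rewrite (le_trans (ler_normD _ _))// lerD//.
- apply: le_trans (tensor_combination_le b0 _) _.
    move=> v hv; apply: taylor_at_le => //.
    by apply: (near_diff _ cx cy hv) => k z; exact: knear.
  have hz : \prod_k \sum_b `|wD k b| <= 4 * kappa * (4 * kappa * h).
    apply: (@prod_le2 _ _ _ i j).
    - by move=> k; apply: sumr_ge0.
    - move=> k /negbTE ki /negbTE kj; under eq_bigr do rewrite /wD kj /dpouw ki.
      by rewrite (sum_norm_pou (ltn_ord (c k)) (cell_of k cx)).
    - by rewrite mulr_ge0.
    - move=> ij; under eq_bigr do rewrite /wD (negbTE ij) /dpouw eqxx.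
      exact: (sum_norm_dpou kappa0 (ltn_ord (c i)) (cell_of i cx)).
    - rewrite eq_sym => /negbTE ij; under eq_bigr do rewrite /wD eqxx /dpouw ij.
      apply: le_trans (sum_norm_pouB kappa0 (ltn_ord (c j)) (cell_of j cx) (cell_of j cy)) _.
      by rewrite ler_wpM2l// mulr_ge0.
    - move=> ij; under eq_bigr do rewrite /wD eqxx /dpouw (introT eqP (esym ij)).
      apply: le_trans (sum_norm_dpouB kappa0 (ltn_ord (c j)) (cell_of j cx) (cell_of j cy)) _.
      apply: (@le_trans _ _ (8 * kappa ^+ 2 * h)).
        by rewrite ler_wpM2l// mulr_ge0// exprn_ge0.
      rewrite (_ : 4 * kappa * (4 * kappa * h) = 16 * (kappa ^+ 2 * h)); last by ring.
      by rewrite -mulrA ler_wpM2r ?mulr_ge0 ?exprn_ge0// ler_nat.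
  apply: le_trans (ler_wpM2r b0 hz) _.
  rewrite [leLHS](_ : _ = 16 * d%:R * (kappa * om * h) * (kappa / n%:R)); last by ring.
  by rewrite -[leRHS]mulr1 ler_wpM2l ?mulr_ge0// ler_pdivrMr// mul1r.
- have oh0 : 0 <= om * h by rewrite mulr_ge0.
  apply: le_trans (tensor_combination_le oh0 _) _.
    move=> v /(near_dpouw cy) cv; have [v01 xv] := near_node cx cv.
    by rewrite normrM ler_pM//; apply: osc.
  by rewrite ler_wpM2r// (prod_dpouw_le _ cy).
- apply: le_trans (tensor_combination_le om0 _) _.
    move=> v hv; have cv : near c v.
      by apply: (near_diff _ cx cy hv) => k z; exact: knear'.
    have [v01 xv] := near_node cx cv; exact: osc.
  rewrite ler_wpM2r// -[leRHS]mul1r.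
  apply: (@prod_le2 _ _ _ j j) => //.
  - by move=> k; apply: sumr_ge0.
  - move=> k /negbTE kj _; under eq_bigr do rewrite /wP kj.
    by rewrite (sum_norm_pou (ltn_ord (c k)) (cell_of k cx)).
  - by rewrite eqxx.
  - by rewrite eqxx.
  - move=> _; under eq_bigr do rewrite /wP eqxx.
    rewrite mul1r.
    apply: le_trans (sum_norm_pouB kappa0 (ltn_ord (c j)) (cell_of j cx) (cell_of j cy)) _.
    by rewrite ler_wpM2l// mulr_ge0.
Qed.

Lemma dsmooth_lip c x y i h : cube d x -> cube d y -> in_box c x -> in_box c y ->
  (forall k, `|x 0 k - y 0 k| <= h) ->
  `|dsmooth x i - dsmooth y i| <= d%:R * (16 * d%:R + 8) * kappa * om * h.
Proof.
move=> x01 y01 cx cy hxy.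
(* Replacing the coordinates of [x] by those of [y] one after the other never leaves the box, as a
   box is a product. *)
pose z (t : nat) : 'rV[R]_d := \row_k (if (k < t)%N then y 0 k else x 0 k).
have z01 t : cube d (z t) by move=> k; rewrite mxE; case: ifP.
have cz t : in_box c (z t) by move=> k; rewrite mxE; case: ifP.
have step t : (t < d)%N ->
    `|dsmooth (z t) i - dsmooth (z t.+1) i| <= (16 * d%:R + 8) * (kappa * om * h).
  move=> td; apply: (@dsmooth_step c _ _ i (Ordinal td)) => //.
    move=> k kt; rewrite !mxE ltnS [(k <= t)%N]leq_eqVlt.
    by rewrite (_ : (k == t :> nat) = false)//; apply: contra_neqF kt => /eqP e; apply/val_inj.
  by rewrite !mxE/= ltnn ltnSn.
have tele t : (t <= d)%N ->
    `|dsmooth (z 0%N) i - dsmooth (z t) i| <= t%:R * ((16 * d%:R + 8) * (kappa * om * h)).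
  elim: t => [_|t IH td]; first by rewrite subrr normr0 mul0r.
  rewrite -(subrK (dsmooth (z t) i) (dsmooth (z 0%N) i)) -addrA.
  rewrite (le_trans (ler_normD _ _))// -natr1 mulrDl mul1r lerD//; last exact: step.
  exact/IH/ltnW.
have -> : x = z 0%N by apply/rowP => k; rewrite mxE.
have -> : y = z d by apply/rowP => k; rewrite mxE ltn_ord.
by rewrite -!mulrA; have := tele d (leqnn d); rewrite -!mulrA.
Qed.

End smoothing.

(** * Derivatives of the smoothed function *)

Lemma is_derive_bigsum (R : realFieldType) (V W : normedModType R) (I : Type) (r : seq I)
    (f : I -> V -> W) (df : I -> W) (x v : V) :
  (forall k, is_derive x v (f k) (df k)) ->
  is_derive x v (fun y => \sum_(k <- r) f k y) (\sum_(k <- r) df k).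
Proof.
move=> fd; elim: r => [|k r IH].
  rewrite big_nil (_ : (fun=> _) = cst 0); first exact: is_derive_cst.
  by apply/funext => y; rewrite big_nil.
rewrite big_cons (_ : (fun=> _) = f k + (fun y => \sum_(k <- r) f k y)).
  exact: is_deriveD.
by apply/funext => y; rewrite big_cons.
Qed.

Lemma continuous_bigsum (R : realFieldType) (T : topologicalType) (I : Type) (r : seq I)
    (f : I -> T -> R) : (forall k, continuous (f k)) ->
  continuous (fun y => \sum_(k <- r) f k y).
Proof.
move=> fc; elim: r => [|k r IH] y.
  by under eq_fun do rewrite big_nil; exact: cvg_cst.
by under eq_fun do rewrite big_cons; apply: cvgD; [exact: fc|exact: IH].
Qed.

Lemma continuous_bigprod (R : realFieldType) (T : topologicalType) (I : Type) (r : seq I)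
    (f : I -> T -> R) : (forall k, continuous (f k)) ->
  continuous (fun y => \prod_(k <- r) f k y).
Proof.
move=> fc; elim: r => [|k r IH] y.
  by under eq_fun do rewrite big_nil; exact: cvg_cst.
by under eq_fun do rewrite big_cons; apply: cvgM; [exact: fc|exact: IH].
Qed.

Lemma differentiable_bigsum (R : realFieldType) (V W : normedModType R) (I : Type) (r : seq I)
    (f : I -> V -> W) x : (forall k, differentiable (f k) x) ->
  differentiable (fun y => \sum_(k <- r) f k y) x.
Proof.
move=> fd; elim: r => [|k r IH].
  rewrite (_ : (fun=> _) = cst 0); first exact: differentiable_cst.
  by apply/funext => y; rewrite big_nil.
rewrite (_ : (fun=> _) = f k + (fun y => \sum_(k <- r) f k y)).
  exact: differentiableD.
by apply/funext => y; rewrite big_cons.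
Qed.

Lemma differentiable_bigprod (R : realFieldType) (V : normedModType R) (I : Type) (r : seq I)
    (f : I -> V -> R) x : (forall k, differentiable (f k) x) ->
  differentiable (fun y => \prod_(k <- r) f k y) x.
Proof.
move=> fd; elim: r => [|k r IH].
  rewrite (_ : (fun=> _) = cst 1); first exact: differentiable_cst.
  by apply/funext => y; rewrite big_nil.
rewrite (_ : (fun=> _) = f k * (fun y => \prod_(k <- r) f k y)).
  exact: differentiableM.
by apply/funext => y; rewrite big_cons.
Qed.

Lemma is_derive_coord (R : realFieldType) (d : nat) (f : 'rV[R]_d -> R) (x : 'rV[R]_d) i
    (g : R -> R) (l : R) :
  (forall h : R, f (h *: delta_mx 0 i + x) = g (h + x 0 i)) ->
  is_derive (x 0 i) 1 g l -> is_derive x (delta_mx 0 i) f l.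
Proof.
move=> fg [gd <-].
have e : (fun h => h^-1 *: ((f \o shift x) (h *: delta_mx 0 i) - f x)) =
    (fun h => h^-1 *: ((g \o shift (x 0 i)) (h *: 1) - g (x 0 i))).
  apply/funext => h /=; congr (_ *: (_ - _)).
    by rewrite fg; congr (g (_ + _)); exact: esym (mulr1 h).
  by rewrite -[X in f X](add0r x) -(scale0r (delta_mx 0 i)) fg add0r.
by split; [rewrite /derivable e|rewrite /derive e].
Qed.

Section smooth_derive.
Variables (R : realType) (d n : nat) (kappa : R).
Variables (F : 'rV[R]_d -> R) (P : 'rV[R]_d -> 'I_d -> R).
Local Notation smooth := (smooth n kappa F P).
Local Notation dsmooth := (dsmooth n kappa F P).

Lemma differentiable_smooth x : differentiable smooth x.
Proof.
have dc i : differentiable (fun y : 'rV[R]_d => y 0 i) x by exact: differentiable_coord.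
apply: differentiable_bigsum => v.
apply: (@differentiableM _ _ (fun y => tensor (pouw kappa y) v)).
  apply: (@differentiable_bigprod _ _ _ _ (fun i y => pouw kappa y i (v i))) => i.
  apply: (@differentiable_comp _ _ _ _ (fun y : 'rV[R]_d => y 0 i)
    (pou kappa (v i)) x (dc i)).
  by apply/derivable1_diffP; have := is_derive_pou kappa (v i) (x 0 i); case.
rewrite (_ : taylor_at F P v = cst (F (node R v)) + (fun y : 'rV[R]_d =>
  \sum_i (cst (P (node R v) i) * ((fun z : 'rV[R]_d => z 0 i) - cst (node R v 0 i))) y)) //.
apply: differentiableD; first exact: differentiable_cst.
apply: differentiable_bigsum => i; apply: differentiableM; first exact: differentiable_cst.
by apply: differentiableB; [exact: dc|exact: differentiable_cst].
Qed.

Lemma is_derive_smooth x i : is_derive x (delta_mx 0 i) smooth (dsmooth x i).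
Proof.
apply: is_derive_bigsum => v.
(* Along the i-th axis a summand is p(s) C (a + P s), with [C] and [a] collecting everything that
   stays fixed. *)
pose C := \prod_(k | k != i) pou kappa (v k) (x 0 k).
pose a := F (node R v) +
  \sum_(k | k != i) P (node R v) k * (x 0 k - node R v 0 k) - P (node R v) i * node R v 0 i.
apply: (@is_derive_coord _ _ _ _ _
  (fun s => (pou kappa (v i) s * C) * (a + P (node R v) i * s))).
  move=> h; congr (_ * _).
    rewrite /tensor (bigD1 i)//= /pouw !mxE !eqxx /= mulr1; congr (_ * _).
    by apply: eq_bigr => k ki; rewrite !mxE (negbTE ki) mulr0 add0r.
  rewrite /taylor_at (bigD1 i)//= !mxE !eqxx /= mulr1 /a mxE.
  under eq_bigr => k ki do rewrite !mxE (negbTE ki) mulr0 add0r.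
  under [in RHS]eq_bigr => k ki do rewrite !mxE.
  by ring.
have -> : tensor (dpouw kappa i x) v = dpou kappa (v i) (x 0 i) * C.
  rewrite /tensor (bigD1 i)//= /dpouw eqxx; congr (_ * _).
  by apply: eq_bigr => k /negbTE ->.
have -> : tensor (pouw kappa x) v = pou kappa (v i) (x 0 i) * C.
  by rewrite /tensor (bigD1 i).
have -> : taylor_at F P v x = a + P (node R v) i * x 0 i.
  rewrite /taylor_at (bigD1 i)//= /a; ring.
have := is_derive_pou kappa (v i) (x 0 i).
set p := pou kappa (v i); set p' := dpou _ _ _ => pd.
have h1 : is_derive (x 0 i) 1 (p * cst C) (p' * C).
  apply: (is_derive_eq (is_deriveM pd (is_derive_cst C (x 0 i) 1))).
  by rewrite scaler0 add0r; exact: mulrC.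
have h2 : is_derive (x 0 i) 1 (cst a + cst (P (node R v) i) * id) (P (node R v) i).
  apply: (is_derive_eq (is_deriveD (is_derive_cst a (x 0 i) 1)
    (is_deriveM (is_derive_cst _ (x 0 i) 1) (is_derive_id (x 0 i) 1)))).
  by rewrite scaler0 add0r addr0; exact: mulr1.
apply: (is_derive_eq (is_deriveM h1 h2)).
by rewrite addrC; congr (_ + _); exact: mulrC.
Qed.

Lemma continuous_dsmooth i : continuous (dsmooth ^~ i).
Proof.
have cc (k : 'I_d) : continuous (fun y : 'rV[R]_d => y 0 k) by exact: coord_continuous.
have cp (k : 'I_d) (q : R -> R) : continuous q -> continuous (fun y : 'rV[R]_d => q (y 0 k)).
  by move=> qc y; apply: continuous_comp; [exact: cc|exact: qc].
apply: continuous_bigsum => v.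
have c1 : continuous (fun y => tensor (dpouw kappa i y) v).
  apply: (@continuous_bigprod _ _ _ _ (fun k y => dpouw kappa i y k (v k))) => k.
  rewrite /dpouw; case: (k == i); first by apply: (cp k (dpou kappa (v k))); exact: continuous_dpou.
  by apply: (cp k (pou kappa (v k))); exact: continuous_pou.
have c2 : continuous (fun y => tensor (pouw kappa y) v).
  apply: (@continuous_bigprod _ _ _ _ (fun k y => pouw kappa y k (v k))) => k.
  by apply: (cp k (pou kappa (v k))); exact: continuous_pou.
have c3 : continuous (taylor_at F P v).
  have cs : continuous (fun y : 'rV[R]_d => \sum_k P (node R v) k * (y 0 k - node R v 0 k)).
    apply: (@continuous_bigsum _ _ _ _
      (fun k (y : 'rV[R]_d) => P (node R v) k * (y 0 k - node R v 0 k))).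
    by move=> k z; exact: (cvgM (cvg_cst _) (cvgB (cc k z) (cvg_cst _))).
  by move=> y; exact: (cvgD (cvg_cst _) (cs y)).
by move=> x; exact: (cvgD (cvgM (c1 x) (c3 x)) (cvgM (c2 x) (cvg_cst _))).
Qed.

End smooth_derive.

(** * Norms, Jacobians and Taylor's formula on the closed cube *)

Lemma norm_entry_le_enorm (R : realType) n (u : 'rV[R]_n) i : `|u 0 i| <= enorm u.
Proof.
rewrite -sqrtr_sqr ler_wsqrtr// (bigD1 i)//= lerDl sumr_ge0// => k _.
exact: sqr_ge0.
Qed.

Lemma enorm_mul_le (R : realType) (n p : nat) (A : 'M[R]_(n, p)) (v : 'rV[R]_n) (a : R) :
  (forall i, `|v 0 i| <= 1) -> (forall j, \sum_i `|A i j| <= a) -> 0 <= a ->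
  enorm (v *m A) <= Num.sqrt p%:R * a.
Proof.
move=> v1 Aa a0; apply: enorm_le_max => // j; rewrite mxE.
apply: le_trans (Aa j); apply: le_trans (ler_norm_sum _ _ _) _.
by apply: ler_sum => i _; rewrite normrM ler_piMl.
Qed.

Lemma opnorm_le (R : realType) (n p : nat) (A : 'M[R]_(n, p)) (a : R) :
  (forall j, \sum_i `|A i j| <= a) -> 0 <= a -> opnorm A <= Num.sqrt p%:R * a.
Proof.
move=> Aa a0; apply: ge_sup.
  exists (enorm (0 *m A)), 0 => //=.
  rewrite /enorm big1 ?sqrtr0// => i _; by rewrite mxE expr0n.
move=> _ [v /= v1 <-]; apply: enorm_mul_le => // i.
exact: le_trans (norm_entry_le_enorm _ _) v1.
Qed.

Lemma norm_entry_le_opnorm (R : realType) (n p : nat) (A : 'M[R]_(n, p)) i j :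
  `|A i j| <= opnorm A.
Proof.
(* A crude bound, present only to show that the set in [opnorm] is bounded, without which [sup] says
   nothing. *)
pose a := \sum_i \sum_j `|A i j|.
have a0 : 0 <= a by rewrite sumr_ge0// => k _; rewrite sumr_ge0.
have Aa k : \sum_l `|A l k| <= a.
  apply: ler_sum => l _; rewrite (bigD1 k)//= lerDl sumr_ge0//.
have -> : A i j = ((delta_mx 0 i : 'rV[R]_n) *m A) 0 j by rewrite -rowE mxE.
apply: le_trans (norm_entry_le_enorm _ _) _.
apply: ub_le_sup; last first.
  exists (delta_mx 0 i) => //=.
  rewrite /enorm (bigD1 i)//= mxE !eqxx expr1n big1 ?addr0 ?sqrtr1// => k ki.
  by rewrite mxE (negbTE ki) andbF expr0n.
exists (Num.sqrt p%:R * a) => _ [v /= v1 <-]; apply: enorm_mul_le => // k.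
exact: le_trans (norm_entry_le_enorm _ _) v1.
Qed.

Lemma is_derive_line (R : realFieldType) (V W : normedModType R) (f : V -> W) (x v : V)
    (g : R -> W) (s : R) (l : W) :
  (forall h : R, f (h *: v + x) = g (h + s)) ->
  is_derive x v f l -> is_derive s 1 g l.
Proof.
move=> fg [fd <-].
have e : (fun h => h^-1 *: ((f \o shift x) (h *: v) - f x)) =
    (fun h => h^-1 *: ((g \o shift s) (h *: 1) - g s)).
  apply/funext => h /=; congr (_ *: (_ - _)).
    by rewrite fg; congr (g (_ + _)); exact: esym (mulr1 h).
  by rewrite -[X in f X](add0r x) -(scale0r v) fg add0r.
by split; [rewrite /derivable -e|rewrite /derive -e].
Qed.

Lemma derive_jacobian_entry (R : realType) (d m : nat) (f : 'rV[R]_d -> 'rV[R]_m)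
    (x v : 'rV[R]_d) j : differentiable f x ->
  is_derive x v (fun y => f y 0 j) (\sum_i 'J f x i j * v 0 i).
Proof.
move=> fd; have fv : derivable f x v by exact: diff_derivable.
split; first by move/derivable_mxP : fv; exact.
have := congr1 (fun u : 'rV[R]_m => u 0 j) (derive_mx fv).
rewrite /= mxE => <-; rewrite deriveEjacobian// mxE.
by apply: eq_bigr => i _; rewrite mulrC.
Qed.

Lemma jacobian_entry (R : realType) (d m : nat) (f : 'rV[R]_d -> 'rV[R]_m)
    (x : 'rV[R]_d) i j l : differentiable f x ->
  is_derive x (delta_mx 0 i) (fun y => f y 0 j) l -> 'J f x i j = l.
Proof.
move=> fd [_ <-]; have := derive_jacobian_entry (delta_mx 0 i) j fd.
have dE k : (delta_mx 0 i : 'rV[R]_d) 0 k = (k == i)%:R by rewrite mxE eqxx.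
case=> _ ->; rewrite (bigD1 i)//= dE eqxx mulr1 big1 ?addr0// => k ki.
by rewrite dE (negbTE ki) mulr0.
Qed.

Section cube.
Variables (R : realType) (d : nat).
Implicit Types x v : 'rV[R]_d.

Definition center : 'rV[R]_d := const_mx 2^-1.

(** Enters the open cube from any point of the closed one; statements known inside are carried to
    the boundary by letting t tend to 0. *)
Definition inward x (t : R) : 'rV[R]_d := x + t *: (center - x).

Lemma inward_open x t : cube d x -> 0 < t <= 1 -> open_cube d (inward x t).
Proof.
move=> x01 /andP[t0 t1] i; rewrite !mxE; have /andP[x0 x1] := x01 i.
by apply/andP; split; nra.
Qed.

Lemma open_cubeW x : open_cube d x -> cube d x.
Proof. by move=> x01 i; have /andP[/ltW -> /ltW ->] := x01 i. Qed.

Lemma cvg_inward x : cube d x ->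
  inward x t @[t --> 0^'+] --> within (open_cube d) (nbhs x).
Proof.
move=> x01.
have c0 : inward x t @[t --> 0^'+] --> x.
  apply: cvg_at_right_filter.
  rewrite -[X in _ --> X]addr0 -(scale0r (center - x)).
  apply: cvgD; first exact: cvg_cst.
  by apply: cvgZr_tmp => //; exact: cvg_id.
move=> A nA; rewrite -[nbhs _ A]/(\forall t \near 0^'+, A (inward x t)); near=> t.
have t01 : 0 < t <= 1.
  apply/andP; split; first by near: t; exact: nbhs_right_gt.
  by near: t; exact: nbhs_right_le.
have A1 : open_cube d (inward x t) -> A (inward x t) by near: t; exact: (c0 _ nA).
by apply: A1; exact: inward_open.
Unshelve. all: by end_near. Qed.

(** Makes the [lim] in [Dcube] unique, at boundary points as well. *)
Lemma within_open_cube_proper x : cube d x -> ProperFilter (within (open_cube d) (nbhs x)).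
Proof.
move=> x01; have cv := cvg_inward x01.
apply: Build_ProperFilter_ex => A nA.
have [t [_ At]] : exists t, True /\ A (inward x t).
  have /(@filter_ex _ 0^'+) : \forall t \near 0^'+, A (inward x t) := cv _ nA.
  by case=> t At; exists t.
by exists (inward x t).
Qed.

Lemma within_open_cube_sub x :
  within (open_cube d) (nbhs x) --> within (cube d) (nbhs x).
Proof.
move=> A nA; rewrite -[nbhs _ A]/(\forall y \near x, open_cube d y -> A y).
near=> y => /open_cubeW; near: y; exact: nA.
Unshelve. all: by end_near. Qed.

Section C1.
Variables (m : nat) (f : 'rV[R]_d -> 'rV[R]_m) (Df : 'rV[R]_d -> 'M[R]_(d, m)).
Hypothesis Dfc : {within cube d, continuous Df}.
Hypothesis fD : forall x, open_cube d x -> 'J f x = Df x.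

Lemma DcubeE x : cube d x -> Dcube f x = Df x.
Proof.
move=> x01; have pf := within_open_cube_proper x01.
apply: cvg_lim => //.
apply: (@cvg_trans _ (Df y @[y --> within (open_cube d) (nbhs x)])).
  apply: near_eq_cvg; rewrite near_withinE; near=> y => /fD ->//.
have /subspace_continuousP/(_ x x01) := Dfc.
apply: cvg_trans; apply: cvg_app; exact: within_open_cube_sub.
Unshelve. all: by end_near. Qed.

End C1.

Section taylor.
Variables (m : nat) (f : 'rV[R]_d -> 'rV[R]_m) (Df : 'rV[R]_d -> 'M[R]_(d, m)).
Hypothesis fc : {within cube d, continuous f}.
Hypothesis Dfc : {within cube d, continuous Df}.
Hypothesis fD : forall x, open_cube d x -> differentiable f x /\ 'J f x = Df x.
Variables (r om : R) (j : 'I_m).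
Hypothesis osc : forall x y, cube d x -> cube d y ->
  (forall i, `|x 0 i - y 0 i| <= r) -> forall i, `|Df x i j - Df y i j| <= om.

Let taylor_open x v : open_cube d x -> open_cube d v ->
  (forall i, `|x 0 i - v 0 i| <= r) ->
  `|f x 0 j - f v 0 j - \sum_i Df v i j * (x 0 i - v 0 i)| <=
    \sum_i om * `|x 0 i - v 0 i|.
Proof.
move=> x01 v01 xv.
pose z (t : R) := v + t *: (x - v).
have z01 t : 0 <= t <= 1 -> open_cube d (z t).
  move=> /andP[t0 t1] i; rewrite !mxE.
  have /andP[x0 x1] := x01 i; have /andP[v0 v1] := v01 i.
  by have [?|?] := leP (v 0 i) (x 0 i); apply/andP; split; nra.
pose g (t : R) : R := f (z t) 0 j.
pose dg t := \sum_i Df (z t) i j * (x 0 i - v 0 i).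
have gd (t : R) : 0 <= t <= 1 -> is_derive t 1 g (dg t).
  move=> /z01 zt; have [fzt Jzt] := fD zt.
  apply: (@is_derive_line _ _ _ (fun y => f y 0 j) (z t) (x - v)).
    by move=> h; rewrite /g /z scalerDl addrCA.
  have := derive_jacobian_entry (x - v) j fzt; rewrite Jzt.
  by under eq_bigr do rewrite !mxE.
have [||t t01 gE] := @MVT R g dg 0 1 ltr01.
- move=> t; rewrite in_itv/= => /andP[t0 t1]; apply: gd.
  by rewrite (ltW t0) (ltW t1).
- apply: derivable_within_continuous => t; rewrite in_itv/= => t01.
  by have [] := gd t t01.
have t01' : 0 <= t <= 1.
  by move: t01; rewrite in_itv/= => /andP[/ltW -> /ltW ->].
have -> : f x 0 j - f v 0 j = dg t.
  have z1 : z 1 = x by rewrite /z scale1r addrC subrK.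
  have z0 : z 0 = v by rewrite /z scale0r addr0.
  by move: gE; rewrite /g z1 z0 subr0 mulr1.
rewrite /dg -sumrB; apply: le_trans (ler_norm_sum _ _ _) _.
apply: ler_sum => i _; rewrite -mulrBl normrM ler_wpM2r//.
apply: osc; [exact/open_cubeW/z01|exact: open_cubeW|] => k.
rewrite !mxE addrAC subrr add0r normrM; case/andP: t01' => t0 t1.
by rewrite ger0_norm// (le_trans _ (xv k))// ler_piMl.
Qed.

(** The mean value theorem is available only on segments inside the open cube; by continuity of [f]
    and [Df] the inequality then extends to the closed cube. *)
Lemma taylor_cube x v : cube d x -> cube d v ->
  (forall i, `|x 0 i - v 0 i| <= r) ->
  `|f x 0 j - f v 0 j - \sum_i Df v i j * (x 0 i - v 0 i)| <=
    \sum_i om * `|x 0 i - v 0 i|.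
Proof.
move=> x01 v01 xv.
have cin y (T : topologicalType) (q : 'rV[R]_d -> T) : cube d y ->
    {within cube d, continuous q} -> q (inward y t) @[t --> 0^'+] --> q y.
  move=> y01 /subspace_continuousP/(_ y y01); apply: cvg_trans.
  apply: (@cvg_trans _ (q z @[z --> within (open_cube d) (nbhs y)])).
    by move=> A nA; exact: (cvg_inward y01 nA).
  by apply: cvg_app; exact: within_open_cube_sub.
have cid y i : cube d y -> inward y t 0 i @[t --> 0^'+] --> y 0 i.
  move=> y01; apply: (cin y _ (fun u : 'rV[R]_d => u 0 i) y01).
  by apply: continuous_subspaceT; exact: coord_continuous.
have cf y : cube d y -> f (inward y t) 0 j @[t --> 0^'+] --> f y 0 j.
  move=> y01; have h1 := cin y _ f y01 fc.
  exact: (cvg_comp _ _ h1 (@coord_continuous R 1 m 0 j (f y))).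
have cD i : Df (inward v t) i j @[t --> 0^'+] --> Df v i j.
  have h1 := cin v _ Df v01 Dfc.
  exact: (cvg_comp _ _ h1 (@coord_continuous R d m i j (Df v))).
have csum (h : 'I_d -> R -> R) (l : 'I_d -> R) : (forall i, h i t @[t --> 0^'+] --> l i) ->
    \sum_i h i t @[t --> 0^'+] --> \sum_i l i.
  move=> hl; elim: (index_enum _) => [|k s IH].
    by under eq_fun do rewrite big_nil; rewrite big_nil; exact: cvg_cst.
  by under eq_fun do rewrite big_cons; rewrite big_cons; exact: (cvgD (hl k) IH).
have h1 : \sum_i Df (inward v t) i j * (inward x t 0 i - inward v t 0 i) @[t --> 0^'+]
    --> \sum_i Df v i j * (x 0 i - v 0 i).
  by apply: csum => i; exact: (cvgM (cD i) (cvgB (cid x i x01) (cid v i v01))).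
have h2 : f (inward x t) 0 j - f (inward v t) 0 j -
     \sum_i Df (inward v t) i j * (inward x t 0 i - inward v t 0 i) @[t --> 0^'+]
    --> f x 0 j - f v 0 j - \sum_i Df v i j * (x 0 i - v 0 i).
  exact: (cvgB (cvgB (cf x x01) (cf v v01)) h1).
have h3 i : `|inward x t 0 i - inward v t 0 i| @[t --> 0^'+] --> `|x 0 i - v 0 i|.
  exact: (cvg_norm (cvgB (cid x i x01) (cid v i v01))).
have h4 : \sum_i om * `|inward x t 0 i - inward v t 0 i| @[t --> 0^'+]
    --> \sum_i om * `|x 0 i - v 0 i|.
  by apply: csum => i; exact: (cvgM (cvg_cst om) (h3 i)).
apply: (ler_cvg_to (cvg_norm h2) h4); near=> t.
have t01 : 0 < t <= 1.
  apply/andP; split; first by near: t; exact: nbhs_right_gt.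
  by near: t; exact: nbhs_right_le.
  apply: taylor_open => [||i]; try exact: inward_open.
  (* Both points move towards the same center, so their difference shrinks and stays below [r]. *)
  rewrite !mxE (_ : _ - _ = (1 - t) * (x 0 i - v 0 i)); last by ring.
  case/andP: t01 => t0 t1; rewrite normrM ger0_norm ?subr_ge0//.
  by rewrite (le_trans _ (xv i))// ler_piMl// gerBl ltW.
Unshelve. all: by end_near. Qed.

End taylor.
End cube.

(** * Constants and the grid *)

Lemma differentiable_row (R : realType) (V : normedModType R) (m : nat) (g : 'I_m -> V -> R) x :
  (forall j, differentiable (g j) x) -> differentiable (fun y => \row_j g j y) x.
Proof.
move=> gd; rewrite (_ : (fun _ => _) = (fun y => \sum_j g j y *: delta_mx 0 j)).
  by apply: differentiable_bigsum => j; apply: differentiableZl; exact: gd.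
by apply/funext => y; rewrite [LHS]row_sum_delta; apply: eq_bigr => j _; rewrite mxE.
Qed.

Lemma continuous_mx (R : realType) (T : topologicalType) (n m : nat) (g : T -> 'M[R]_(n, m)) :
  (forall i j, continuous (fun y => g y i j)) -> continuous g.
Proof.
move=> gc y; apply/cvgrPdist_le => /= e e0; near=> z.
rewrite /Num.Def.normr/= mx_normrE (bigmax_le _ (ltW e0))//= => i _.
rewrite !mxE/=; move: i; near: z; apply: filter_forall => /= i.
exact: ((cvgrPdist_le _ _).1 (gc i.1 i.2 y)).
Unshelve. all: by end_near. Qed.

(** [constant_lt] with denominators cleared. 4^m pays for 4 m^2 and 3 d for 2 d + 1; the remaining
    10 m^4 <= 10 d^4 is left to 2^(d-1) d! (d + 1)^4, where d = 1 and d = 2 are settled by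
    computation. *)
Lemma count_constant (d m : nat) : (0 < m)%N -> (m <= d)%N ->
  (40 * m ^ 6 * (2 * d + 1) < 3 * 2 ^ (2 * m + d - 1) * d`! * d * (d + 1) ^ 4)%N.
Proof.
move=> m0 md.
have d0 : (0 < d)%N by exact: leq_trans md.
have m2 : (m ^ 2 * 4 <= 4 ^ m)%N.
  have : (m <= 2 ^ m.-1)%N by rewrite -{1}(prednK m0) ltn_expl.
  rewrite -(leq_exp2r _ _ (isT : (0 < 2)%N)) -expnM mulnC expnM => h.
  have -> : (4 ^ m = 4 * 4 ^ m.-1)%N by rewrite -expnS prednK.
  by rewrite mulnC leq_pmul2l.
have -> : (2 ^ (2 * m + d - 1) = 4 ^ m * 2 ^ (d - 1))%N.
  by rewrite -addnBA// expnD expnM.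
have key : (10 * d ^ 4 < 2 ^ (d - 1) * d`! * (d + 1) ^ 4)%N.
  case: d d0 {md} => [//|[//|[//|d]]] _.
  have h1 : (4 <= 2 ^ (d.+3 - 1))%N by rewrite (leq_pexp2l (m := 2) (n1 := 2)).
  have h2 : (6 <= d.+3`!)%N by elim: d {h1} => // d; rewrite (factS d.+3); nia.
  have h3 : (d.+3 ^ 4 < (d.+3 + 1) ^ 4)%N by rewrite ltn_exp2r// addn1.
  apply: (@leq_trans (10 * (d.+3 + 1) ^ 4)); first by rewrite ltn_pmul2l.
  by rewrite leq_pmul2r ?expn_gt0 ?addn1//; apply: leq_trans (leq_mul h1 h2).
have m6 : (40 * m ^ 6 * (2 * d + 1) <= 4 ^ m * (10 * d ^ 4) * (3 * d))%N.
  have m4 : (m ^ 4 <= d ^ 4)%N by rewrite leq_exp2r.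
  have d3 : (2 * d + 1 <= 3 * d)%N by lia.
  rewrite leq_mul//.
  rewrite (_ : 40 * m ^ 6 = m ^ 2 * 4 * (10 * m ^ 4))%N; last by rewrite !expnS; ring.
  by rewrite leq_mul// leq_mul2l m4 orbT.
apply: leq_ltn_trans m6 _.
rewrite (_ : 3 * _ * _ * _ * _ =
  4 ^ m * (2 ^ (d - 1) * d`! * (d + 1) ^ 4) * (3 * d))%N; last by ring.
by rewrite ltn_pmul2r ?muln_gt0// ltn_pmul2l ?expn_gt0.
Qed.
Lemma sqrt_nat_bounds (R : realType) (d : nat) : (0 < d)%N ->
  1 <= Num.sqrt d%:R :> R /\ Num.sqrt d%:R <= d%:R :> R.
Proof.
move=> d0; have d1 : 1 <= d%:R :> R by rewrite ler1n.
have q1 : 1 <= Num.sqrt d%:R :> R by rewrite -{1}(sqrtr1 R) ler_wsqrtr.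
by split=> //; rewrite -[leRHS]sqr_sqrtr ?ler0n// expr2 ler_peMl// (le_trans ler01).
Qed.

(** On the left stands 5/2 m^4 Lam / T for the parameters of the main bound, where [om] cancels. The
    right side is the target divided by sqrt d^(d-1), the price of the box diameters; the power d^d
    in [K] covers it. *)
Lemma constant_lt (R : realType) (d m : nat) (delta om K : R) : (0 < m)%N -> (m <= d)%N ->
  0 < delta -> 0 < om ->
  K = 4 * (d%:R ^+ d * Num.sqrt d%:R) * (d%:R + 1) ^+ 4 ->
  5 / 2 * m%:R ^+ 4 * (d%:R * (16 * d%:R + 8) * (2 / delta) * om) /
    (3 * K * om / (4 * m%:R ^+ 2)) <
  (d%:R * 2 ^+ (2 * m + d - 1) * (d`!)%:R) / (delta * Num.sqrt d%:R ^+ (d - 1)).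
Proof.
move=> m0 md delta0 om0 ->; have d0 : (0 < d)%N by exact: leq_trans md.
have [q1 qd] := sqrt_nat_bounds R d0.
have : (40 * m ^ 6 * (2 * d + 1))%N%:R <
    (3 * 2 ^ (2 * m + d - 1) * d`! * d * (d + 1) ^ 4)%N%:R :> R.
  by rewrite ltr_nat count_constant.
rewrite [ltLHS]natrM [X in X * _ < _]natrM natrX natrD [(2 * d)%:R]natrM.
rewrite [ltRHS]natrM [X in _ < X * _]natrM [X in _ < X * _ * _]natrM.
rewrite [X in _ < X * _ * _ * _]natrM !natrX natrD.
set E2 := 2 ^+ (2 * m + d - 1); set C := d%:R * E2 * _; set q := Num.sqrt d%:R in q1 qd *.
set D := d%:R in C qd *; set M := m%:R; set P := (_ + 1) ^+ 4.
rewrite [ltRHS](_ : _ = 3 * C * P); last by rewrite /C; ring.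
move=> hC.
have D0 : 0 < D by rewrite ltr0n.
have M0 : 0 < M by rewrite ltr0n.
have q0 : 0 < q by apply: lt_le_trans q1.
have P0 : 0 < P by rewrite exprn_gt0// ltr_wpDr.
have qn0 : 0 < q ^+ (d - 1) by rewrite exprn_gt0.
have Dn0 : 0 < D ^+ (d - 1) by rewrite exprn_gt0.
rewrite ltr_pdivlMr ?mulr_gt0//.
rewrite (_ : D ^+ d = D * D ^+ (d - 1)); last by rewrite -exprS subn1 prednK.
have qD : q ^+ (d - 1) <= D ^+ (d - 1) by apply: lerXn2r; rewrite // nnegrE ltW.
set Q := q ^+ (d - 1) in qn0 qD *; set E := D ^+ (d - 1) in Dn0 qD *.
rewrite [ltLHS](_ : _ = (40 * M ^+ 6 * (2 * D + 1)) / (3 * P) * (Q / E) / q); last first.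
  by field; rewrite !gt_eqF.
apply: (@le_lt_trans _ _ ((40 * M ^+ 6 * (2 * D + 1)) / (3 * P))); last first.
  have P3 : 0 < 3 * P by apply: mulr_gt0.
  by rewrite ltr_pdivrMr// (_ : C * (3 * P) = 3 * C * P)//; ring.
have X0 : 0 <= (40 * M ^+ 6 * (2 * D + 1)) / (3 * P).
  rewrite divr_ge0 ?mulr_ge0 ?exprn_ge0 ?addr_ge0 ?mulr_ge0//; exact: ltW.
rewrite ler_pdivrMr// -[leLHS]mulr1.
apply: ler_pM => //; first by rewrite mulr_ge0// divr_ge0// ltW.
by rewrite ler_piMr// ler_pdivrMr// mul1r.
Qed.

(* For [delta > 1] the slope vanishes: the interpolation is then affine. *)
Lemma grid_ex (R : realType) (delta : R) : 0 < delta ->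
  exists n, exists kappa : R, [/\ (0 < n)%N, 0 <= kappa, kappa <= n%:R, n%:R^-1 <= delta &
    kappa <= 2 / delta /\
    forall (a : 'I_n) s, a%:R <= n%:R * s <= a.+1%:R -> 0 <= kappa * s - a%:R <= 1].
Proof.
move=> delta0; have [d1|d1] := leP delta 1.
  have i1 : 1 <= delta^-1 by rewrite invf_ge1.
  (* n > 1 / delta keeps the mesh below delta, and n <= 1 / delta + 1 <= 2 / delta because delta <=
     1. *)
  exists (Num.truncn delta^-1).+1, (Num.truncn delta^-1).+1%:R; split => //.
    by rewrite -[leRHS]invrK lef_pV2 ?posrE ?ltr0n ?invr_gt0//; exact/ltW/truncnS_gt.
  split; last first.
    by move=> a s; rewrite -[a.+1%:R]natr1 => /andP[? ?]; apply/andP; split; lra.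
  rewrite -natr1 mulrDl mul1r lerD// truncn_le; exact: le_trans i1.
exists 1%N, 0; split => //; first by rewrite invr1 ltW.
split; first by rewrite divr_ge0// ltW.
by move=> a s _; rewrite ord1 mul0r subr0 lexx ler01.
Qed.

(** * The perturbed smoothing *)

Lemma differentiable_rows (R : realType) (d m : nat) (g : 'rV[R]_d -> 'rV[R]_m) x :
  (forall j, differentiable (fun y => g y 0 j) x) -> differentiable g x.
Proof.
move=> gd; rewrite (_ : g = (fun y => \row_j g y 0 j)); first exact: differentiable_row.
by apply/funext => y; apply/rowP => j; rewrite mxE.
Qed.

Lemma is_derive_jacobian (R : realType) (d m : nat) (f : 'rV[R]_d -> 'rV[R]_m) x i j :
  differentiable f x -> is_derive x (delta_mx 0 i) (fun y => f y 0 j) ('J f x i j).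
Proof.
move=> fd; have := derive_jacobian_entry (delta_mx 0 i) j fd.
have dE k : (delta_mx 0 i : 'rV[R]_d) 0 k = (k == i)%:R by rewrite mxE eqxx.
by rewrite (bigD1 i)//= dE eqxx mulr1 big1 ?addr0// => k ki; rewrite dE (negbTE ki) mulr0.
Qed.

Section embed_rows.
Variables (R : realType) (d m : nat) (hmd : (m <= d)%N).
Let top : 'I_m -> 'I_d := widen_ord hmd.

(** The sum has at most one term; it puts 0 in the rows below the first m without a case
    distinction. *)
Definition embed_rows (B : 'M[R]_m) : 'M[R]_(d, m) :=
  \matrix_(i, j) \sum_(k | top k == i) B k j.

Lemma rowsub_embed_rows B : rowsub top (embed_rows B) = B.
Proof.
by apply/matrixP => i j; rewrite !mxE (big_pred1 i).
Qed.

Lemma sum_embed_rows_le (B : 'M[R]_m) (t : R) j : (forall i j, `|B i j| <= t) ->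
  \sum_i `|embed_rows B i j| <= m%:R * t.
Proof.
move=> Bt; apply: (@le_trans _ _ (\sum_i \sum_(k | top k == i) `|B k j|)).
  by apply: ler_sum => i _; rewrite mxE ler_norm_sum.
rewrite (exchange_big_dep xpredT)//=.
apply: (@le_trans _ _ (\sum_(k < m) t)).
  by apply: ler_sum => k _; rewrite (big_pred1 (top k)).
by rewrite sumr_const card_ord -[leLHS]mulr_natl.
Qed.

End embed_rows.

Section perturbed_smoothing.
Variables (R : realType) (d m : nat).
Variables (n : nat) (kappa : R) (f : 'rV[R]_d -> 'rV[R]_m) (Df : 'rV[R]_d -> 'M[R]_(d, m)).
Variable B : 'M[R]_(d, m).

Definition smooth_row (x : 'rV[R]_d) : 'rV[R]_m :=
  \row_j smooth n kappa (fun y => f y 0 j) (fun y i => Df y i j) x.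

Definition dsmooth_mx (x : 'rV[R]_d) : 'M[R]_(d, m) :=
  \matrix_(i, j) dsmooth n kappa (fun y => f y 0 j) (fun y i => Df y i j) x i.

Definition perturbed (x : 'rV[R]_d) : 'rV[R]_m := smooth_row x + x *m B.

Lemma differentiable_perturbed x : differentiable perturbed x.
Proof.
apply: differentiable_rows => j.
rewrite (_ : (fun y => _) = smooth n kappa (fun y => f y 0 j) (fun y i => Df y i j) +
   (fun y : 'rV[R]_d => \sum_k ((fun z : 'rV[R]_d => z 0 k) * cst (B k j)) y)); last first.
  by apply/funext => y; rewrite !mxE.
apply: differentiableD; first exact: differentiable_smooth.
apply: differentiable_bigsum => k; apply: differentiableM; first exact: differentiable_coord.
exact: differentiable_cst.
Qed.

Lemma jacobian_perturbed x : 'J perturbed x = dsmooth_mx x + B.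
Proof.
apply/matrixP => i j; apply: jacobian_entry; first exact: differentiable_perturbed.
have -> : (fun y => perturbed y 0 j) =
    smooth n kappa (fun y => f y 0 j) (fun y i => Df y i j) +
    (fun y : 'rV[R]_d => (y *m B) 0 j).
  by apply/funext => y; rewrite mxE [X in X + _]mxE.
have -> : (dsmooth_mx x + B) i j =
    dsmooth n kappa (fun y => f y 0 j) (fun y i => Df y i j) x i + B i j.
  by rewrite !mxE.
apply: is_deriveD; first exact: is_derive_smooth.
pose c := (x *m B) 0 j - B i j * x 0 i.
have hc : is_derive (x 0 i) 1 (cst c + cst (B i j) * id) (B i j).
  apply: (is_derive_eq (is_deriveD (is_derive_cst c (x 0 i) 1)
    (is_deriveM (is_derive_cst _ (x 0 i) 1) (is_derive_id (x 0 i) 1)))).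
  by rewrite scaler0 add0r addr0; exact: mulr1.
have fc (h : R) : ((h *: delta_mx 0 i + x) *m B) 0 j = (cst c + cst (B i j) * id) (h + x 0 i).
  rewrite mulmxDl -scalemxAl -rowE mxE [X in X + _]mxE [X in h * X]mxE.
  by rewrite -[RHS]/(c + B i j * (h + x 0 i)) /c; ring.
exact: is_derive_coord fc hc.
Qed.

Lemma continuous_dsmooth_mx : continuous (fun x => dsmooth_mx x + B).
Proof.
apply: continuous_mx => i j.
rewrite (_ : (fun y => _) = (fun y =>
  dsmooth n kappa (fun y => f y 0 j) (fun y i => Df y i j) y i + B i j)); last first.
  by apply/funext => y; rewrite !mxE.
by move=> y; exact: (cvgD (@continuous_dsmooth _ _ _ _ _ _ i y) (cvg_cst _)).
Qed.

Lemma C1_cube_perturbed : C1_cube perturbed.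
Proof.
split.
  apply: continuous_subspaceT => x.
  exact/differentiable_continuous/differentiable_perturbed.
exists (fun x => dsmooth_mx x + B); split.
  exact/continuous_subspaceT/continuous_dsmooth_mx.
by move=> x _; split; [exact: differentiable_perturbed|exact: jacobian_perturbed].
Qed.

Hypothesis Dfc : {within cube d, continuous Df}.
Hypothesis fD : forall x, open_cube d x -> differentiable f x /\ 'J f x = Df x.

Lemma Dcube_perturbed x : cube d x ->
  Dcube (fun y => perturbed y - f y) x = dsmooth_mx x + B - Df x.
Proof.
move=> x01.
apply: (@DcubeE _ _ _ (fun y => perturbed y - f y) (fun y => dsmooth_mx y + B - Df y)) => //.
  apply/subspace_continuousP => y y01.
  have /subspace_continuousP/(_ y y01) hD := Dfc.
  have hG : dsmooth_mx z + B @[z --> within (cube d) (nbhs y)] --> dsmooth_mx y + B.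
    by apply: cvg_within_filter; exact: continuous_dsmooth_mx.
  exact: (cvgB hG hD).
move=> y y01; have [fy Jy] := fD y01; have gy := differentiable_perturbed y.
apply/matrixP => i j; apply: jacobian_entry; first exact: differentiableB.
have -> : (fun z => (perturbed z - f z) 0 j) =
    (fun z => perturbed z 0 j) - (fun z => f z 0 j).
  by apply/funext => z; rewrite mxE [X in _ + X]mxE.
have -> : (dsmooth_mx y + B - Df y) i j = 'J perturbed y i j - 'J f y i j.
  by rewrite jacobian_perturbed Jy mxE [X in _ + X]mxE.
by apply: is_deriveB; exact: is_derive_jacobian.
Qed.

End perturbed_smoothing.

(** Sup norm distance delta means Euclidean distance at most sqrt d * delta, which is why [beta]
    evaluates the modulus there. *)
Lemma omegaD_osc (R : realType) (d m : nat) (f : 'rV[R]_d -> 'rV[R]_m)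
    (Df : 'rV[R]_d -> 'M[R]_(d, m)) (delta om : R) :
  (0 < d)%N -> 0 < delta -> {within cube d, continuous Df} ->
  (forall x, open_cube d x -> 'J f x = Df x) ->
  (omegaD f (Num.sqrt d%:R * delta) <= om%:E)%E ->
  forall x y, cube d x -> cube d y -> (forall i, `|x 0 i - y 0 i| <= delta) ->
  forall i j, `|Df x i j - Df y i j| <= om.
Proof.
move=> d0 delta0 Dfc fD; rewrite /omegaD mulr_gt0// ?sqrtr_gt0 ?ltr0n// => ho.
move=> x y x01 y01 xy i j.
apply: (@le_trans _ _ (opnorm (Dcube f x - Dcube f y))).
  rewrite (DcubeE Dfc fD x01) (DcubeE Dfc fD y01).
  by apply: le_trans (norm_entry_le_opnorm _ i j); rewrite !mxE.
rewrite -lee_fin; apply: le_trans ho; apply: ereal_sup_ubound.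
exists y, x; split => //; apply: enorm_le_max => [|k]; first exact: ltW.
by rewrite !mxE distrC.
Qed.

(** * Nested boxes *)

Lemma in_box_coarsen (R : realFieldType) (d n l : nat) (c : {ffun 'I_d -> 'I_(n * l.+1)}) :
  exists c' : {ffun 'I_d -> 'I_n}, forall x : 'rV[R]_d, in_box c x -> in_box c' x.
Proof.
have h i : (c i %/ l.+1 < n)%N by rewrite ltn_divLR.
exists [ffun i => Ordinal (h i)] => x cx i; rewrite ffunE /=.
have /andP[c1 c2] := cx i.
have l0 : 0 < l.+1%:R :> R by rewrite ltr0n.
have nE : n%:R * x 0 i * l.+1%:R = (n * l.+1)%:R * x 0 i by rewrite mulrAC -natrM.
apply/andP; split; rewrite -(ler_pM2r l0) nE -natrM.
  by apply: le_trans c1; rewrite ler_nat leq_trunc_div.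
by apply: le_trans c2 _; rewrite ler_nat; exact: ltn_ceil.
Qed.

Lemma in_box_cube (R : realFieldType) (d N : nat) (c : {ffun 'I_d -> 'I_N}) (x : 'rV[R]_d) :
  in_box c x -> forall i, 0 <= x 0 i <= 1.
Proof.
move=> cx i; have /andP[c1 c2] := cx i.
have N0 : 0 < N%:R :> R by rewrite ltr0n (leq_ltn_trans _ (ltn_ord (c i))).
rewrite -(ler_pM2l N0) mulr0 (le_trans _ c1)//=.
by rewrite -(ler_pM2l N0) mulr1 (le_trans c2)// ler_nat ltn_ord.
Qed.

Lemma in_box_close (R : realFieldType) (d N : nat) (c : {ffun 'I_d -> 'I_N}) (x y : 'rV[R]_d) :
  in_box c x -> in_box c y -> forall i, `|x 0 i - y 0 i| <= N%:R^-1.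
Proof.
move=> cx cy i; have /andP[x1 x2] := cx i; have /andP[y1 y2] := cy i.
have N0 : 0 < N%:R :> R by rewrite ltr0n (leq_ltn_trans _ (ltn_ord (c i))).
rewrite -(ler_pM2l N0) divff ?gt_eqF// -[X in X * _](gtr0_norm N0) -normrM mulrBr.
by move: x2 y2; rewrite -!natr1 ler_norml => x2 y2; apply/andP; split; lra.
Qed.

(** * The bound for a fixed delta *)

Section main_bound.
Variables (R : realType) (d m : nat).
Hypotheses (hm : (1 <= m)%N) (hmd : (m <= d)%N).
Variable f : 'rV[R]_d -> 'rV[R]_m.
Hypothesis hf : C1_cube f.
Variables (eps delta : R).
Hypotheses (heps : 0 < eps) (hdelta : 0 < delta).
Hypothesis hbeta : (beta f delta <= eps%:E)%E.

Let C : R := d%:R * 2 ^+ (2 * m + d - 1) * (d`!)%:R.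
Let K : R := 4 * (d%:R ^+ d * Num.sqrt d%:R) * (d%:R + 1) ^+ 4.
Let S : R := 1 + Num.sqrt d%:R * delta + K.
Let om : R := eps / S.
(** In value and in derivative together, the perturbation costs at most sqrt m * m * T <= m^2 T,
    which is three quarters of K om. *)
Let T : R := 3 * K * om / (4 * m%:R ^+ 2).
Let Lam : R := d%:R * (16 * d%:R + 8) * (2 / delta) * om.

Let d0 : (0 < d)%N. Proof. exact: leq_trans hmd. Qed.
Let dR0 : 0 < d%:R :> R. Proof. by rewrite ltr0n d0. Qed.
Let mR0 : 0 < m%:R :> R. Proof. by rewrite ltr0n. Qed.
Let q0 : 0 < Num.sqrt d%:R :> R. Proof. by rewrite sqrtr_gt0. Qed.
Let K0 : 0 < K.
Proof.
have P0 : 0 < (d%:R + 1) ^+ 4 :> R by rewrite exprn_gt0// ltr_wpDr.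
apply: mulr_gt0 => //; apply: mulr_gt0 => //; apply: mulr_gt0 => //.
exact: exprn_gt0.
Qed.
Let S0 : 0 < S.
Proof. by rewrite addr_gt0// ltr_wpDr// mulr_ge0// ltW. Qed.
Let om0 : 0 < om. Proof. by rewrite divr_gt0. Qed.
Let T0 : 0 < T.
Proof.
apply: divr_gt0; first by do 2 apply: mulr_gt0 => //.
by apply: mulr_gt0 => //; exact: exprn_gt0.
Qed.
Let Lam0 : 0 < Lam.
Proof.
apply: mulr_gt0 => //; apply: mulr_gt0; last exact: divr_gt0.
by apply: mulr_gt0 => //; rewrite ltr_wpDl// mulr_ge0// ltW.
Qed.

Let omega_le : (omegaD f (Num.sqrt d%:R * delta) <= om%:E)%E.
Proof.
have SE : 1 + Num.sqrt d%:R * delta + 4 * (d%:R `^ (d%:R + 2^-1)) * (d%:R + 1) ^+ 4 = S.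
  rewrite /S /K powRD; last by rewrite gt_eqF ?implybT// .
  by rewrite powR_mulrn ?ltW// powR12_sqrt ?ltW.
move: hbeta; rewrite /beta SE /om EFinM => h.
by rewrite lee_pdivlMr.
Qed.

(* The error of the smoothing takes at most a quarter of the budget [K * om]. *)
Let error_le : Num.sqrt m%:R * (d%:R * om + m%:R * (T / 2)) +
  Num.sqrt m%:R * (d%:R * ((4 * d%:R + 1) * om) + m%:R * (T / 2)) <= eps.
Proof.
have [_ qm] := sqrt_nat_bounds R hm.
have [q1 _] := sqrt_nat_bounds R d0.
have md : m%:R <= d%:R :> R by rewrite ler_nat.
have qq : Num.sqrt m%:R <= Num.sqrt d%:R :> R by rewrite ler_wsqrtr.
have eS : eps = S * om by rewrite /om mulrC divfK// gt_eqF.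
apply: (@le_trans _ _ (K * om)); last first.
  by rewrite eS ler_wpM2r ?(ltW om0)// /S lerDr addr_ge0// mulr_ge0// ltW.
have hT : Num.sqrt m%:R * (m%:R * T) <= 3 / 4 * K * om.
  rewrite [leRHS](_ : _ = m%:R * (m%:R * T)); last first.
    by rewrite /T; field; rewrite gt_eqF.
  by rewrite ler_wpM2r// mulr_ge0// ltW.
have hd : Num.sqrt m%:R * (d%:R * (4 * d%:R + 2) * om) <= 1 / 4 * K * om.
  rewrite mulrA; apply: ler_wpM2r; first exact: ltW.
  rewrite [leRHS](_ : _ = Num.sqrt d%:R * (d%:R ^+ d * (d%:R + 1) ^+ 4)); last first.
    by rewrite /K; field.
  have dp0 : 0 <= 4 * d%:R + 2 :> R by rewrite addr_ge0// mulr_ge0.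
  apply: ler_pM; rewrite ?sqrtr_ge0 ?mulr_ge0//.
  apply: ler_pM => //.
    by rewrite -{1}[d%:R]expr1 ler_weXn2l// ler1n.
  have d1 : 1 <= d%:R :> R by rewrite ler1n.
  have -> : (d%:R + 1) ^+ 4 =
    (d%:R ^+ 2 * (d%:R ^+ 2 + 4 * d%:R + 6)) + (4 * d%:R + 1) :> R by ring.
  have : 1 * (1 + 4 * 1 + 6) <= d%:R ^+ 2 * (d%:R ^+ 2 + 4 * d%:R + 6) :> R.
    have d2 : 1 <= d%:R ^+ 2 :> R by rewrite exprn_ege1.
    by apply: ler_pM => //; lra.
  lra.
rewrite [leLHS](_ : _ = Num.sqrt m%:R * (d%:R * (4 * d%:R + 2) * om) +
  Num.sqrt m%:R * (m%:R * T)); last by field.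
by lra.
Qed.

Lemma Ncrit_le : (Ncrit f eps <= (C / delta)%:E)%E.
Proof.
have [fc [Df [Dfc fD]]] := hf.
have osc := omegaD_osc d0 hdelta Dfc (fun x h => (fD x h).2) omega_le.
have [n [kappa [n0 kappa0 kappan ndelta [kdelta kcell]]]] := grid_ex hdelta.
have nR0 : 0 < n%:R :> R by rewrite ltr0n.
have taylor j x v : cube d x -> cube d v ->
    (forall i, `|x 0 i - v 0 i| <= n%:R^-1) ->
    `|f x 0 j - f v 0 j - \sum_i Df v i j * (x 0 i - v 0 i)| <=
      \sum_i om * `|x 0 i - v 0 i|.
  apply: (taylor_cube fc Dfc fD) => y z y01 z01 yz i; apply: osc => // k.
  exact: le_trans (yz k) ndelta.
have osc' j x v : cube d x -> cube d v ->
    (forall i, `|x 0 i - v 0 i| <= n%:R^-1) -> forall i, `|Df v i j - Df x i j| <= om.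
  move=> x01 v01 xv i; rewrite distrC; apply: osc => // k.
  exact: le_trans (xv k) ndelta.
pose top : 'I_m -> 'I_d := widen_ord hmd.
pose M x := rowsub top (dsmooth_mx n kappa f Df x).
have Mlip l (c : {ffun 'I_d -> 'I_(n * l.+1)}) x : in_box c x ->
    forall i j, `|M x i j - M (corner R c) i j| <= Lam / (n * l.+1)%:R.
  move=> cx i j; rewrite !mxE.
  have N0 : (0 < n * l.+1)%N by rewrite muln_gt0 n0.
  have cc := in_box_corner R c N0.
  have [c' cc'] := in_box_coarsen R c.
  apply: le_trans (dsmooth_lip n0 kappa0 kappan kcell (ltW om0) (taylor j) (osc' j) _
    (in_box_cube cx) (in_box_cube cc) (cc' _ cx) (cc' _ cc) (in_box_close cx cc)) _.
  rewrite /Lam; apply: ler_wpM2r; first by rewrite invr_ge0.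
  apply: ler_wpM2r; first exact: ltW.
  apply: ler_wpM2l => //; apply: mulr_ge0 => //.
(* The factor sqrt d^(d-1) is divided out because [hausdorff_measure_le] brings it back. *)
pose A : R := C / (delta * Num.sqrt d%:R ^+ (d - 1)).
have hA : 5 / 2 * m%:R ^+ 4 * Lam / T < A by apply: constant_lt.
have [B Bb BP] := good_perturbation_ex d0 hm n0 T0 Lam0 Mlip hA.
have [B' B'b B'E] : exists2 B' : 'M[R]_(d, m),
    forall j, \sum_i `|B' i j| <= m%:R * (T / 2) & rowsub top B' = B.
  exists (embed_rows hmd B); first by move=> j; exact: sum_embed_rows_le.
  exact: rowsub_embed_rows.
pose g := perturbed n kappa f Df B'.
have T20 : 0 <= T / 2 by rewrite divr_ge0// ltW.
have mT20 : 0 <= m%:R * (T / 2) by apply: mulr_ge0.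
have gf x : cube d x -> enorm (g x - f x) <= Num.sqrt m%:R * (d%:R * om + m%:R * (T / 2)).
  move=> x01; apply: enorm_le_max => [|j].
    by apply: addr_ge0 => //; apply: mulr_ge0 => //; exact: ltW.
  have -> : (g x - f x) 0 j =
      smooth n kappa (fun y => f y 0 j) (fun y i => Df y i j) x - f x 0 j +
      \sum_k x 0 k * B' k j by rewrite addrAC !mxE.
  rewrite (le_trans (ler_normD _ _))// lerD//.
    apply: le_trans (smooth_approx n0 kcell (ltW om0) (taylor j) x01) _.
    rewrite ler_pdivrMr// ler_peMr ?ler1n//.
    by apply: mulr_ge0 => //; exact: ltW.
  apply: le_trans (B'b j); apply: le_trans (ler_norm_sum _ _ _) _.
  apply: ler_sum => k _; rewrite normrM ler_piMl//.
  by have /andP[x0 x1] := x01 k; rewrite ger0_norm.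
have Dgf x : cube d x -> opnorm (Dcube (fun y => g y - f y) x) <=
    Num.sqrt m%:R * (d%:R * ((4 * d%:R + 1) * om) + m%:R * (T / 2)).
  move=> x01; rewrite (Dcube_perturbed _ _ _ Dfc fD x01).
  have d4 : 0 <= (4 * d%:R + 1) * om.
    by apply: mulr_ge0; [apply: addr_ge0 => //; exact: mulr_ge0|exact: ltW].
  apply: opnorm_le => [j|]; last by apply: addr_ge0 => //; exact: mulr_ge0.
  apply: (@le_trans _ _ (\sum_(i < d) ((4 * d%:R + 1) * om + `|B' i j|))).
    apply: ler_sum => i _; rewrite addrAC mxE (le_trans (ler_normD _ _))// lerD2r.
    rewrite !mxE.
    exact: (dsmooth_approx n0 kappa0 kappan kcell (ltW om0) (taylor j) (osc' j) i x01).
  by rewrite big_split/= sumr_const card_ord -[X in X + _ <= _]mulr_natl lerD2l.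
apply: (@le_trans _ _ (hausdorff_measure (d - 1) (critical_set g))).
  apply: ereal_inf_lbound; exists g; last reflexivity.
  split.
    exact: C1_cube_perturbed.
  apply: (@le_trans _ _ ((Num.sqrt m%:R * (d%:R * om + m%:R * (T / 2)))%:E +
    (Num.sqrt m%:R * (d%:R * ((4 * d%:R + 1) * om) + m%:R * (T / 2)))%:E)%E); last first.
    by rewrite -EFinD lee_fin.
  apply: leeD; apply: ge_ereal_sup => _ [x x01 <-]; rewrite lee_fin.
    exact: gf.
  exact: Dgf.
have -> : C / delta = Num.sqrt d%:R ^+ (d - 1) * A.
  rewrite /A mulrCA; congr (_ * _).
  by rewrite invfM mulrCA divff ?mulr1// gt_eqF// exprn_gt0.
apply: (@hausdorff_measure_le _ _ _ (fun l => (n * l.+1)%N)).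
  by move=> l; rewrite -[X in (X <= _)%N]mul1n leq_mul.
move=> l0; have [l l0l [S' S'A S'P]] := BP l0; exists l => //; exists S' => //.
move=> x [x01 rx]; apply: S'P; first exact: open_cubeW.
have := rank_near_singular top hm rx; rewrite jacobian_perturbed /M => <-.
congr (\det _); apply/matrixP => i j; by rewrite -B'E !mxE.
Qed.

End main_bound.

(* The inverse of the library on \bar R satisfies +oo^-1 = 0. *)
Theorem theorem3p3 (R : realType) (d m : nat) (hm : (1 <= m)%N) (hmd : (m <= d)%N)
    (f : 'rV[R]_d -> 'rV[R]_m) (hf : C1_cube f)
    (hnc : ~ exists c : 'rV[R]_m, forall x, cube d x -> f x = c)
    (eps : R) (heps : 0 < eps) :
  (Ncrit f eps <=
     (d%:R * 2 ^+ (2 * m + d - 1) * (d`!)%:R)%R%:E * (beta_inv f eps)^-1)%E.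
Proof.
set C : R := d%:R * _ * _.
have C0 : 0 < C.
  by rewrite !mulr_gt0 ?exprn_gt0 ?ltr0n ?fact_gt0// (leq_trans hm).
have key (delta : R) : 0 < delta -> (beta f delta <= eps%:E)%E ->
    (Ncrit f eps <= (C / delta)%:E)%E by move=> delta0 hb; exact: Ncrit_le.
have beta0 : (0%:E <= beta_inv f eps)%E.
  apply: ereal_sup_ubound; exists 0 => //; split=> //.
  by rewrite /beta /omegaD mulr0 ltxx mul0e lee_fin ltW.
have lt_beta (e : R) : (e%:E < beta_inv f eps)%E ->
    exists2 delta : R, e < delta & (beta f delta <= eps%:E)%E.
  move=> /ereal_sup_gt[_ [delta [_ hb] <-]]; rewrite lte_fin => ed.
  by exists delta.
case: (beta_inv f eps) beta0 lt_beta => [s| |//]; rewrite ?lee_fin => s0 lt_beta.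
- move: s0; rewrite le_eqVlt => /predU1P[<-|s0].
    (* Here the right-hand side is +oo. *)
    by rewrite inve0 gt0_muley ?lte_fin// leey.
  rewrite inver gt_eqF// -EFinM.
  apply/lee_addgt0Pr => e e0.
  (* Solves C / t = C / s + e. As t < s, some admissible delta exceeds [t]; the supremum itself need
     not be attained. *)
  pose t := C / (C / s + e).
  have Cs0 : 0 < C / s by rewrite divr_gt0.
  have t0 : 0 < t by rewrite divr_gt0// addr_gt0.
  have ts : t < s.
    rewrite /t ltr_pdivrMr ?addr_gt0// mulrDr mulrC divfK ?gt_eqF//.
    by rewrite ltrDl mulr_gt0.
  have [|delta tdelta hb] := lt_beta t; first by rewrite lte_fin.
  have delta0 : 0 < delta by apply: lt_trans tdelta.
  apply: le_trans (key delta delta0 hb) _; rewrite -EFinD lee_fin.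
  rewrite ler_pdivrMr// mulrC -ler_pdivrMr ?addr_gt0//; exact: ltW.
- rewrite invey mule0; apply/lee_addgt0Pr => e e0; rewrite add0e.
  (* Admissible delta are arbitrarily large, and any one above C / e gives a bound below e. *)
  have [|delta tdelta hb] := lt_beta (C / e); first by rewrite ltry.
  have delta0 : 0 < delta by apply: lt_trans tdelta; rewrite divr_gt0.
  apply: le_trans (key delta delta0 hb) _; rewrite lee_fin.
  rewrite ler_pdivrMr// mulrC -ler_pdivrMr//; exact: ltW.
Qed.
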